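(* The parallel-in-time fixed-stress split method defined in the context is convergent for any stabilization parameter $L \ge \dfrac{\alpha^2}{2\left(\frac{2G}{d}+\lambda\right)}$. Moreover, with $\delta p_h^{n,i} = p_h^{n,i}-p_h^{n,i-1}$ ($i\ge1$) denoting the difference between two successive pressure approximations and $\bar\partial_t \delta p_h^{n,i}=(\delta p_h^{n,i}-\delta p_h^{n-1,i})/\tau$, there holds, for $i\ge 2$, $$\sum_{n=1}^N \tau \| \bar{\partial}_t \delta p_h^{n,i} \|^2 \;\le\; \frac{L}{\frac{1}{\beta}+L}\sum_{n=1}^N \tau \| \bar{\partial}_t \delta p_h^{n,i-1} \|^2 .$$
   Context: Setting. $\Omega\subset\mathbb{R}^d$, $d\le 3$, is a bounded open set with regular boundary $\Gamma=\Gamma_t\cup\Gamma_c$, where $\Gamma_t,\Gamma_c$ are disjoint and have non-null measure. Physical parameters: Lamé coefficients $G>0$ and $\lambda\ge 0$, Biot coefficient $\alpha>0$, Biot modulus $\beta>0$, fluid viscosity $\mu_f>0$, absolute permeability tensor $\boldsymbol{K}$ (symmetric positive definite), bulk density $\rho$, fluid density $\rho_f$, gravity vector $\boldsymbol{g}$. $(\cdot,\cdot)$ and $\|\cdot\|$ are the $L_2(\Omega)$ inner product and norm. Spaces: $\boldsymbol{V}=\{\boldsymbol{u}\in (H^1(\Omega))^d : \boldsymbol{u}|_{\Gamma_c}=\boldsymbol{0}\}$, $Q=\{p\in H^1(\Omega): p|_{\Gamma_t}=0\}$, and $\boldsymbol{V}_h\subset\boldsymbol{V}$, $Q_h\subset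 Q$ are finite element subspaces. Bilinear forms, with $\boldsymbol{\varepsilon}(\boldsymbol{u})=\frac12(\nabla\boldsymbol{u}+\nabla\boldsymbol{u}^t)$: $$a(\boldsymbol{u},\boldsymbol{v})=2G\int_\Omega \boldsymbol{\varepsilon}(\boldsymbol{u}):\boldsymbol{\varepsilon}(\boldsymbol{v})\,\mathrm{d}\Omega+\lambda\int_\Omega \operatorname{div}\boldsymbol{u}\,\operatorname{div}\boldsymbol{v}\,\mathrm{d}\Omega,\qquad b(p,q)=\int_\Omega \frac{\boldsymbol{K}}{\mu_f}\nabla p\cdot\nabla q\,\mathrm{d}\Omega .$$ Time discretization: uniform partition $\{t_0,t_1,\ldots,t_N\}$ of the time interval with constant step $\tau$, $N\tau=T$. For a sequence $w^0,\ldots,w^N$ write $\bar\partial_t w^n=(w^n-w^{n-1})/\tau$. Sources $f_h^n$ ($n=1,\ldots,N$) are given, and $(\boldsymbol{u}_0,p_0)$ denotes the values of displacement and pressure at $t=0$ specified by the initial condition. Fully discrete (backward Euler) Biot problem: for $n=1,\ldots,N$ find $(\boldsymbol{u}_h^n,p_h^n)\in\boldsymbol{V}_h\times Q_h$ such that $$a(\boldsymbol{u}_h^n,\boldsymbol{v}_h)-\alpha(p_h^n,\operatorname{div}\boldsymbol{v}_h)=(\rho\boldsymbol{g},\boldsymbol{v}_h)\quad\forall\,\boldsymbol{v}_h\in\boldsymbol{V}_h,$$ $$\alpha(\operatorname{div}\bar\partial_t\boldsymbol{u}_h^n,q_h)+\tfrac1\beta(\bar\partial_t p_h^n,q_h)+b(p_h^n,q_h)=(f_h^n,q_h)+(\boldsymbol{K}\mu_f^{-1}\rho_f\boldsymbol{g},\nabla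 q_h)\quad\forall\,q_h\in Q_h.$$ Parallel-in-time fixed-stress split method with stabilization parameter $L$: given an initial guess $\{(\boldsymbol{u}_h^{n,0},p_h^{n,0}),\ n=0,1,\ldots,N\}$, the method gives a sequence of approximations $\{(\boldsymbol{u}_h^{n,i},p_h^{n,i}),\ n=0,1,\ldots,N\}$, $i\ge1$, as follows. Step 1: given $\{(\boldsymbol{u}_h^{n,i-1},p_h^{n,i-1}),\ n=0,1,\ldots,N\}$, find $p_h^{n,i}\in Q_h$, $n=1,\ldots,N$, such that for all $q_h\in Q_h$ $$\left(\tfrac1\beta+L\right)\left(\frac{p_h^{n,i}-p_h^{n-1,i}}{\tau},q_h\right)+b(p_h^{n,i},q_h)=-\alpha\left(\operatorname{div}\frac{\boldsymbol{u}_h^{n,i-1}-\boldsymbol{u}_h^{n-1,i-1}}{\tau},q_h\right)+L\left(\frac{p_h^{n,i-1}-p_h^{n-1,i-1}}{\tau},q_h\right)+(f_h^n,q_h)+(\boldsymbol{K}\mu_f^{-1}\rho_f\boldsymbol{g},\nabla q_h),$$ with $p_h^{0,i}=p_0$. Step 2: given $p_h^{n,i}\in Q_h$, $n=1,\ldots,N$, find $\boldsymbol{u}_h^{n,i}\in\boldsymbol{V}_h$, $n=1,\ldots,N$, such that $$a(\boldsymbol{u}_h^{n,i},\boldsymbol{v}_h)=\alpha(p_h^{n,i},\operatorname{div}\boldsymbol{v}_h)+(\rho\boldsymbol{g},\boldsymbol{v}_h)\quad\forall\,\boldsymbol{v}_h\in\boldsymbol{V}_h.$$ At time level $n=0$ the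 displacement iterate is the initial value, $\boldsymbol{u}_h^{0,i}=\boldsymbol{u}_0$.
   Formalization: At i=2 the inequality is claimed only if the initial guess satisfies Step 2 and takes the values (u_0,p_0) at n=0 (it fails for arbitrary guesses); displacement convergence is in the energy norm a(.,.), and in H^1 when Step 2 determines the displacement uniquely. *)

(* Defs.v *)
From HB Require Import structures.
From mathcomp Require Import all_boot all_order all_algebra.
From mathcomp Require Import all_classical all_reals all_analysis.

Set Implicit Arguments.
Unset Strict Implicit.
Unset Printing Implicit Defensive.

Import Order.TTheory GRing.Theory Num.Theory.
Import numFieldNormedType.Exports.

Local Open Scope classical_set_scope.
Local Open Scope ring_scope.

(* Outer measure generated by a gauge [tau] through countable covers; the
   empty set always has gauge 0. *)
Section cover_outer_measure.
Context {R : realType} {T : Type}.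
Local Open Scope ereal_scope.

Definition gauge0 (tau : set T -> \bar R) (B : set T) : \bar R :=
  if B == set0 then 0 else tau B.

Definition cover_outer (tau : set T -> \bar R) (A : set T) : \bar R :=
  ereal_inf [set \sum_(k <oo) gauge0 tau (F k) |
             F in [set F : (set T)^nat | A `<=` \bigcup_k F k]].

Variable tau : set T -> \bar R.
Hypothesis tau_ge0 : forall B, 0 <= tau B.

Let gauge_ge0 B : 0 <= gauge0 tau B.
Proof. by rewrite /gauge0; case: ifP. Qed.

Lemma cover_outer_ge0 A : 0 <= cover_outer tau A.
Proof.
by apply: le_ereal_inf_tmp => _ [F _ <-]; exact: nneseries_ge0.
Qed.

Lemma cover_outer0 : cover_outer tau set0 = 0.
Proof.
apply/eqP; rewrite eq_le cover_outer_ge0 andbT.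
apply: ereal_inf_lbound; exists (fun=> set0); first by [].
by rewrite eseries0// => i _ _; rewrite /gauge0 eqxx.
Qed.

Lemma le_cover_outer : {homo cover_outer tau : A B / A `<=` B >-> A <= B}.
Proof.
move=> A B AB; apply: ereal_inf_le_tmp => _ [F BF <-].
by exists F => //; exact: subset_trans AB BF.
Qed.

Lemma cover_outer_sigma_subadditive : sigma_subadditive (cover_outer tau).
Proof.
move=> A; have [[i ioo]|] := pselect (exists i, cover_outer tau (A i) = +oo).
  rewrite (eseries_pinfty _ _ ioo) ?leey// => n _.
  by rewrite -ltNye (lt_le_trans _ (cover_outer_ge0 _)).
rewrite -forallNE => Aoo.
suff add2e (e : {posnum R}) : cover_outer tau (\bigcup_n A n) <=
    \sum_(i <oo) cover_outer tau (A i) + e%:num%:E.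
  by apply/lee_addgt0Pr => _/posnumP[].
rewrite (le_trans _ (epsilon_trick _ _ _))//; last first.
  by move=> n; exact: cover_outer_ge0.
pose P n (B : (set T)^nat) := A n `<=` \bigcup_k B k /\
  \sum_(k <oo) gauge0 tau (B k) <=
  cover_outer tau (A n) + (e%:num / (2 ^ n.+1)%:R)%:E.
have [G PG] : {G : ((set T)^nat)^nat & forall n, P n (G n)}.
  apply: (@choice _ _ P) => n; rewrite /P /cover_outer.
  set S := (X in ereal_inf X); move infS : (ereal_inf S) => iS.
  case: iS infS => [r Sr|Soo|Soo].
  - have en1 : (0 < e%:num / (2 ^ n.+1)%:R)%R by [].
    have /(lb_ereal_inf_adherent en1) : ereal_inf S \is a fin_num by rewrite Sr.
    move=> [x [B AnB muBx] xS].
    by exists B; split => //; rewrite muBx -Sr; exact/ltW.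
  - by have := Aoo n; rewrite /cover_outer -/S Soo.
  - suff : lbound S 0 by move/le_ereal_inf_tmp; rewrite Soo.
    by move=> /= _ [B AnB <-]; exact: nneseries_ge0.
pose m := gauge0 tau \o uncurry G.
have m0 x : 0 <= m x by exact: gauge_ge0.
apply: (@le_trans _ _ (\esum_(i in setT) m i)).
  apply: ereal_inf_lbound => /=.
  have /card_esym/ppcard_eqP[f] := card_nat2.
  exists (uncurry G \o f).
    apply: (@subset_trans _  (\bigcup_n \bigcup_k G n k)) => [t [i _]|].
      by move=> /(PG i).1 -[j _ ?]; exists i => //; exists j.
    move=> t [i _ [j _ Bijt]]; exists (f^-1%FUN (i, j)) => //=.
    by rewrite invK ?inE.
  rewrite -(esum_pred_image m _ xpredT) ?[fun=> _]set_true//.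
  by rewrite image_eq.
rewrite (_ : esum _ _ = \sum_(i <oo) \sum_(j <oo) gauge0 tau (G i j)); last first.
  pose J : nat -> set (nat * nat) := fun i => [set (i, j) | j in setT].
  rewrite (_ : setT = \bigcup_k J k); last first.
    by rewrite predeqE => -[a b]; split => // _; exists a => //; exists b.
  rewrite esum_bigcupT /=; last 2 first.
    - apply/trivIsetP => i j _ _ ij.
      rewrite predeqE => -[n k] /=; split => //= -[] [_] _ [<-{n} _].
      by move=> [m' _] [] /esym/eqP; rewrite (negbTE ij).
    - by move=> /= [n k]; exact: m0.
  rewrite -(image_id [set: nat]) -fun_true esum_pred_image//; last first.
    by move=> n _; exact: esum_ge0.
  apply: eq_eseriesr => /= j _.
  rewrite -(esum_pred_image m (pair j) predT)//=; last first.
    by move=> ? ? _ _; exact: (@can_inj _ _ _ snd).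
  by congr esum; rewrite predeqE => -[a b]; split; move=> [i _ <-]; exists i.
apply: lee_lim.
- apply: is_cvg_nneseries => n *.
  by apply: nneseries_ge0 => k *; exact: (m0 (n, k)).
- apply: is_cvg_nneseries => n *; apply: adde_ge0 => //; exact: cover_outer_ge0.
- by near=> n; apply: lee_sum => i _; exact: (PG i).2.
Unshelve. all: by end_near. Qed.

End cover_outer_measure.

Section measures_Rd.
Context {R : realType} {d : nat}.
Local Open Scope ereal_scope.

Definition dotv (x y : 'rV[R]_d) : R := (\sum_i x 0 i * y 0 i)%R.

Definition enorm (x : 'rV[R]_d) : R := Num.sqrt (dotv x x).

Definition box (a b : 'rV[R]_d) : set 'rV[R]_d :=
  [set x | forall i, (a 0 i <= x 0 i <= b 0 i)%R].

(* Least volume of a box containing [B]; for [B] nonempty, [B `<=` box a b]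
   forces [a 0 i <= b 0 i]. *)
Definition box_gauge (B : set 'rV[R]_d) : \bar R :=
  ereal_inf [set (\prod_i `|ab.2 0 i - ab.1 0 i|)%R%:E |
             ab in [set ab : 'rV[R]_d * 'rV[R]_d | B `<=` box ab.1 ab.2]].

Lemma box_gauge_ge0 B : 0 <= box_gauge B.
Proof.
by apply: le_ereal_inf_tmp => _ [ab _ <-]; rewrite lee_fin prodr_ge0.
Qed.

Definition lebesgue_outer : set 'rV[R]_d -> \bar R := cover_outer box_gauge.

HB.instance Definition _ := isOuterMeasure.Build R 'rV[R]_d lebesgue_outer
  (cover_outer0 box_gauge_ge0) (cover_outer_ge0 box_gauge_ge0)
  (@le_cover_outer _ _ box_gauge)
  (cover_outer_sigma_subadditive box_gauge_ge0).

Definition diam (B : set 'rV[R]_d) : \bar R :=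
  ereal_sup [set (enorm (xy.1 - xy.2))%:E | xy in B `*` B].

Definition diam_gauge (s : nat) (delta : R) (B : set 'rV[R]_d) : \bar R :=
  if diam B <= delta%:E then maxe 0 (diam B) ^+ s else +oo.

Lemma diam_gauge_ge0 s delta B : 0 <= diam_gauge s delta B.
Proof.
rewrite /diam_gauge; case: ifP => // _.
by apply: expe_ge0; rewrite le_max lexx.
Qed.

(* Without the usual normalisation constant. *)
Definition hausdorff_outer (s : nat) (A : set 'rV[R]_d) : \bar R :=
  ereal_sup [set cover_outer (diam_gauge s delta) A |
             delta in [set delta : R | (0 < delta)%R]].

Section hausdorff.
Variable s : nat.
Let ge0 delta := @cover_outer_ge0 _ _ _ (diam_gauge_ge0 s delta).

Lemma hausdorff_ge0 A : 0 <= hausdorff_outer s A.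
Proof.
by apply: ereal_sup_ge; exists (cover_outer (diam_gauge s 1) A) => //; exists 1%R => /=.
Qed.

Lemma hausdorff0 : hausdorff_outer s set0 = 0.
Proof.
apply/eqP; rewrite eq_le hausdorff_ge0 andbT.
apply: ge_ereal_sup => _ [delta _ <-].
by rewrite (cover_outer0 (diam_gauge_ge0 _ _)).
Qed.

Lemma le_hausdorff : {homo hausdorff_outer s : A B / A `<=` B >-> A <= B}.
Proof.
move=> A B AB; apply: ge_ereal_sup => _ [delta delta0 <-].
apply: ereal_sup_ge; exists (cover_outer (diam_gauge s delta) B).
  by exists delta.
exact: le_cover_outer.
Qed.

Lemma hausdorff_sigma_subadditive : sigma_subadditive (hausdorff_outer s).
Proof.
move=> F; apply: ge_ereal_sup => _ [delta delta0 <-].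
apply: le_trans (cover_outer_sigma_subadditive (diam_gauge_ge0 s delta) F) _.
apply: lee_nneseries => [i _ _|i _]; first exact: ge0.
by apply: ereal_sup_ubound; exists delta.
Qed.

HB.instance Definition _ := isOuterMeasure.Build R 'rV[R]_d (hausdorff_outer s)
  hausdorff0 hausdorff_ge0 le_hausdorff hausdorff_sigma_subadditive.
End hausdorff.

End measures_Rd.

Section completed_measures_Rd.
Variables (R : realType) (d : nat).

Definition lebesgue_om : {outer_measure set 'rV[R]_d -> \bar R} := lebesgue_outer.

Definition Rd : measurableType _ := caratheodory_type lebesgue_om.

Definition lebesgue_Rd : {measure set Rd -> \bar R} := lebesgue_om.

Definition surface_om : {outer_measure set 'rV[R]_d -> \bar R} :=
  hausdorff_outer d.-1.

Definition surfRd : measurableType _ := caratheodory_type surface_om.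

Definition surface : {measure set surfRd -> \bar R} := surface_om.
End completed_measures_Rd.

Arguments lebesgue_Rd {R d}.
Arguments surface {R d}.
Notation Leb := lebesgue_Rd.

(* A weakly differentiable function is represented by the pair of the function
   and its weak gradient, a Sobolev class by any of its representatives.  For a
   vector field [u], the row [row i (u.2 x)] is the gradient of the component
   [i]. *)
Definition sfield (R : realType) (d : nat) : Type :=
  (('rV[R]_d -> R) * ('rV[R]_d -> 'rV[R]_d))%type.
Definition vfield (R : realType) (d : nat) : Type :=
  (('rV[R]_d -> 'rV[R]_d) * ('rV[R]_d -> 'M[R]_d))%type.

Section sobolev.
Context {R : realType} {d : nat}.
Implicit Types (Omega Gam : set 'rV[R]_d) (f g phi : 'rV[R]_d -> R).
Implicit Types (w : sfield R d) (u : vfield R d).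

Definition square_integrable Omega f : Prop :=
  measurable_fun (Omega : set (Rd R d)) (f : Rd R d -> R) /\
  Leb.-integrable Omega (fun x : Rd R d => (f x ^+ 2)%:E).

Definition ip Omega f g : R := \int[Leb]_(x in Omega) (f x * g x).

Definition sqnorm Omega f : R := ip Omega f f.

Definition pderiv (i : 'I_d) f : 'rV[R]_d -> R :=
  fun x => 'D_(delta_mx 0 i) f x.

Fixpoint Ck (k : nat) f : Prop :=
  continuous f /\
  if k is k'.+1 then
    (forall x (i : 'I_d), derivable f x (delta_mx 0 i)) /\
    (forall i, Ck k' (pderiv i f))
  else True.

Definition smooth f : Prop := forall k, Ck k f.

Definition test_function Omega phi : Prop :=
  smooth phi /\
  exists2 C : set 'rV[R]_d, compact C /\ C `<=` Omega &
    forall x, ~ C x -> phi x = 0.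

Definition weak_gradient Omega f (gf : 'rV[R]_d -> 'rV[R]_d) : Prop :=
  forall phi, test_function Omega phi -> forall i,
    ip Omega f (pderiv i phi) = - ip Omega (fun x => gf x 0 i) phi.

Definition H1 Omega : set (sfield R d) :=
  [set w : sfield R d | [/\ square_integrable Omega w.1,
               forall i, square_integrable Omega (fun x => w.2 x 0 i) &
               weak_gradient Omega w.1 w.2] ].

Definition H1_sqnorm Omega w : R :=
  sqnorm Omega w.1 + \sum_i sqnorm Omega (fun x => w.2 x 0 i).

Definition smooth_field phi : sfield R d := (phi, fun x => \row_i pderiv i phi x).

Definition boundary Omega : set 'rV[R]_d := closure Omega `\` Omega.

(* [g] is the trace of [w]: the limit in [L^2] of the boundary of the
   restrictions of smooth functions that converge to [w] in [H^1]. *)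
Definition is_trace Omega w g : Prop :=
  measurable_fun (boundary Omega : set (surfRd R d)) (g : surfRd R d -> R) /\
  exists phi : nat -> 'rV[R]_d -> R,
    [/\ forall k, smooth (phi k),
        H1_sqnorm Omega (w - smooth_field (phi k)) @[k --> \oo] --> (0 : R) &
        (\int[surface]_(x in boundary Omega) ((phi k x - g x) ^+ 2)%:E)%E
          @[k --> \oo] --> (0 : \bar R)%E].

Definition vanishes_on Omega Gam w : Prop :=
  exists2 g, is_trace Omega w g &
    {ae surface, forall x : surfRd R d, Gam x -> g x = 0}.

Definition component (i : 'I_d) u : sfield R d :=
  (fun x => u.1 x 0 i, fun x => row i (u.2 x)).

Definition H1v Omega : set (vfield R d) :=
  [set u : vfield R d | forall i, H1 Omega (component i u)].

Definition H1v_sqnorm Omega u : R :=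
  \sum_i H1_sqnorm Omega (component i u).

Definition strain u (x : 'rV[R]_d) : 'M[R]_d := 2^-1 *: (u.2 x + (u.2 x)^T).

Definition divg u (x : 'rV[R]_d) : R := \tr (u.2 x).

Definition frob (A B : 'M[R]_d) : R := \sum_i \sum_j A i j * B i j.

(* Locally a strict epigraph of a Lipschitz function along some direction [nu];
   [gam] is a function on the hyperplane orthogonal to [nu], extended
   constantly along [nu]. *)
Definition lipschitz_boundary Omega : Prop :=
  forall x, boundary Omega x ->
    exists (nu : 'rV[R]_d) (gam : 'rV[R]_d -> R) (k : R),
      [/\ enorm nu = 1,
          forall y z, `|gam y - gam z| <= k * enorm (y - z),
          forall y t, gam (y + t *: nu) = gam y &
          \forall y \near x, Omega y <-> gam y < dotv y nu].

End sobolev.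

Definition finite_dim_subspace (R : realType) (E : lmodType R) (S : set E) :
    Prop :=
  exists (m : nat) (e : 'I_m -> E), S = [set \sum_k c k *: e k | c in setT].

Record biot_data (R : realType) (d : nat) := BiotData {
  dom : set 'rV[R]_d;
  Gamma_t : set 'rV[R]_d;
  Gamma_c : set 'rV[R]_d;
  lameG : R;
  lame_lambda : R;
  biot_alpha : R;
  biot_beta : R;
  viscosity : R;
  permeability : 'M[R]_d;
  rho : R;
  rho_f : R;
  gravity : 'rV[R]_d }.

Record biot_data_ok (R : realType) (d : nat) (B : biot_data R d) : Prop := {
  dom_open : open (dom B);
  dom_bounded : bounded_set (dom B);
  dom_regular : lipschitz_boundary (dom B);
  Gamma_cover : boundary (dom B) = Gamma_t B `|` Gamma_c B;
  Gamma_disjoint : Gamma_t B `&` Gamma_c B = set0;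
  Gamma_t_measurable : measurable (Gamma_t B : set (surfRd R d));
  Gamma_c_measurable : measurable (Gamma_c B : set (surfRd R d));
  Gamma_t_nonnull : (0 < surface (Gamma_t B))%E;
  Gamma_c_nonnull : (0 < surface (Gamma_c B))%E;
  lameG_gt0 : 0 < lameG B;
  lame_lambda_ge0 : 0 <= lame_lambda B;
  biot_alpha_gt0 : 0 < biot_alpha B;
  biot_beta_gt0 : 0 < biot_beta B;
  viscosity_gt0 : 0 < viscosity B;
  permeability_sym : (permeability B)^T = permeability B;
  permeability_posdef :
    forall x : 'rV[R]_d, x != 0 -> 0 < dotv (x *m permeability B) x }.

Section biot_forms.
Context {R : realType} {d : nat} (B : biot_data R d).
Local Notation Omega := (dom B).

Definition spaceV : set (vfield R d) :=
  [set u : vfield R d | forall i, H1 Omega (component i u) /\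
                     vanishes_on Omega (Gamma_c B) (component i u)].

Definition spaceQ : set (sfield R d) :=
  [set p : sfield R d | H1 Omega p /\ vanishes_on Omega (Gamma_t B) p].

(* [K xi] for a vector [xi] stored as a row. *)
Definition applyK (xi : 'rV[R]_d) : 'rV[R]_d := xi *m (permeability B)^T.

Definition form_a (u v : vfield R d) : R :=
  2 * lameG B * \int[Leb]_(x in Omega) frob (strain u x) (strain v x) +
  lame_lambda B * \int[Leb]_(x in Omega) (divg u x * divg v x).

Definition form_b (p q : sfield R d) : R :=
  \int[Leb]_(x in Omega) dotv ((viscosity B)^-1 *: applyK (p.2 x)) (q.2 x).

Definition body_load (v : vfield R d) : R :=
  \int[Leb]_(x in Omega) dotv (rho B *: gravity B) (v.1 x).

Definition flow_load (f : 'rV[R]_d -> R) (q : sfield R d) : R :=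
  ip Omega f q.1 +
  \int[Leb]_(x in Omega)
    dotv ((rho_f B / viscosity B) *: applyK (gravity B)) (q.2 x).

End biot_forms.

(* The finite element spaces enter only through being finite-dimensional
   subspaces of the continuous ones. *)
Record discretization (R : realType) (d : nat) := Discretization {
  Vh : set (vfield R d);
  Qh : set (sfield R d);
  final_time : R;
  nsteps : nat;
  tau : R;
  source : nat -> 'rV[R]_d -> R;
  u_init : vfield R d;
  p_init : sfield R d }.

Record discretization_ok (R : realType) (d : nat) (B : biot_data R d)
    (D : discretization R d) : Prop := {
  Vh_finite_dim : finite_dim_subspace (Vh D);
  Vh_sub : Vh D `<=` spaceV B;
  Qh_finite_dim : finite_dim_subspace (Qh D);
  Qh_sub : Qh D `<=` spaceQ B;
  final_time_gt0 : 0 < final_time D;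
  tau_gt0 : 0 < tau D;
  nsteps_tau : (nsteps D)%:R * tau D = final_time D;
  source_L2 : forall n, (1 <= n <= nsteps D)%N ->
    square_integrable (dom B) (source D n);
  u_init_H1 : H1v (dom B) (u_init D);
  p_init_H1 : H1 (dom B) (p_init D) }.

Section fixed_stress.
Context {R : realType} {d : nat} (B : biot_data R d) (D : discretization R d).
Local Notation Omega := (dom B).
Local Notation N := (nsteps D).
Local Notation alpha := (biot_alpha B).
Local Notation beta := (biot_beta B).

Definition dt (E : lmodType R) (w : nat -> E) (n : nat) : E :=
  (tau D)^-1 *: (w n - w n.-1).

Definition mechanics (u : vfield R d) (p : sfield R d) : Prop :=
  Vh D u /\ forall v, Vh D v ->
    form_a B u v = alpha * ip Omega p.1 (divg v) + body_load B v.

Definition biot_solution (u : nat -> vfield R d) (p : nat -> sfield R d) : Prop :=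
  [/\ u 0%N = u_init D, p 0%N = p_init D &
   forall n, (1 <= n <= N)%N ->
    [/\ Vh D (u n), Qh D (p n),
        forall v, Vh D v ->
          form_a B (u n) v - alpha * ip Omega (p n).1 (divg v) =
          body_load B v &
        forall q, Qh D q ->
          alpha * ip Omega (divg (dt u n)) q.1 +
          beta^-1 * ip Omega (dt p n).1 q.1 + form_b B (p n) q =
          flow_load B (source D n) q]].

(* Iterates are indexed as [u i n], [p i n]: iteration [i], time level [n]. *)
Definition initial_guess (u : nat -> vfield R d) (p : nat -> sfield R d) : Prop :=
  [/\ H1v Omega (u 0%N), H1 Omega (p 0%N) &
      forall n, (1 <= n <= N)%N -> Vh D (u n) /\ Qh D (p n)].

Definition flow_step (L : R) (u : nat -> vfield R d) (p p' : nat -> sfield R d) :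
    Prop :=
  p' 0%N = p_init D /\
  forall n, (1 <= n <= N)%N -> Qh D (p' n) /\ forall q, Qh D q ->
    (beta^-1 + L) * ip Omega (dt p' n).1 q.1 + form_b B (p' n) q =
    - alpha * ip Omega (divg (dt u n)) q.1 + L * ip Omega (dt p n).1 q.1 +
    flow_load B (source D n) q.

Definition mechanics_step (p' : nat -> sfield R d) (u' : nat -> vfield R d) :
    Prop :=
  u' 0%N = u_init D /\
  forall n, (1 <= n <= N)%N -> mechanics (u' n) (p' n).

Definition fixed_stress_iterates (L : R) (u : nat -> nat -> vfield R d)
    (p : nat -> nat -> sfield R d) : Prop :=
  initial_guess (u 0%N) (p 0%N) /\
  forall i, (1 <= i)%N ->
    flow_step L (u i.-1) (p i.-1) (p i) /\ mechanics_step (p i) (u i).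

(* The initial guess obeys the same relations as the later iterates do after
   the displacement update. *)
Definition compatible_guess (u : nat -> vfield R d) (p : nat -> sfield R d) :
    Prop :=
  p 0%N = p_init D /\ mechanics_step p u.

(* The mechanics problem determines the displacement in [Vh]; by Korn's
   inequality this holds when every component of [Omega] touches [Gamma_c] in
   positive measure. *)
Definition mechanics_unique : Prop :=
  forall u, Vh D u -> (forall v, Vh D v -> form_a B u v = 0) ->
    H1v_sqnorm Omega u = 0.

Definition iterates_cvg (u : nat -> nat -> vfield R d)
    (p : nat -> nat -> sfield R d) (uh : nat -> vfield R d)
    (ph : nat -> sfield R d) : Prop :=
  forall n, (n <= N)%N ->
    [/\ H1_sqnorm Omega (p i n - ph n) @[i --> \oo] --> (0 : R),
        form_a B (u i n - uh n) (u i n - uh n) @[i --> \oo] --> (0 : R) &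
        mechanics_unique ->
        H1v_sqnorm Omega (u i n - uh n) @[i --> \oo] --> (0 : R)].

Definition fixed_stress_convergent (L : R) : Prop :=
  forall u p, fixed_stress_iterates L u p ->
    (exists uh ph, biot_solution uh ph) /\
    (forall uh ph, biot_solution uh ph -> iterates_cvg u p uh ph).

Definition increment (p : nat -> nat -> sfield R d) (i n : nat) : sfield R d :=
  p i n - p i.-1 n.

Definition increment_energy (p : nat -> nat -> sfield R d) (i : nat) : R :=
  \sum_(1 <= n < N.+1) tau D * sqnorm Omega (dt (increment p i) n).1.

End fixed_stress.

(* Main.v *)
Require Import Defs.
From mathcomp Require Import all_boot all_order all_algebra.
From mathcomp Require Import all_classical all_reals all_analysis.
From mathcomp Require Import measurable_realfun ring lra.

(** The proof compares two runs of the scheme.  The differences [p', p, u] of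
    two runs that share the initial values satisfy the homogeneous equations of
    [homogeneous_step]; two instances matter, the increments of consecutive
    iterates and the errors with respect to a Biot solution, which is a fixed
    point of the scheme for every [L].

    The contraction rests on one estimate.  Write [pi = dt p], [w = dt u] and
    [r = L pi - alpha div w] for the right-hand side of the flow equation.  As
    [a(w, v) = alpha (pi, div v)], expanding the square gives
<<
    |r|^2 = L^2 |pi|^2 - 2 L a(w, w) + alpha^2 |div w|^2 <= L^2 |pi|^2,
>>
    because [(2G/d + lambda) |div w|^2 <= a(w, w)] and the bound on [L] says
    precisely that the last two terms have a nonpositive sum
    ([stabilization_absorbs_div], [residual_le]).  Testing the flow equation
    with [dt p'] and using [2 (r, dt p') <= |r|^2 / L + L |dt p'|^2], the Darcy
    form telescopes in time up to a nonnegative term, and summation over the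
    time levels yields the contraction of [step_contraction].

    For the errors, the contraction makes [sum tau |dt e|^2] decay
    geometrically, and the remaining norms are bounded by it: the values by
    summing the time differences ([value_le_energy]), the gradients by testing
    the flow equation with the error itself ([pressure_H1_le_energy]), the
    displacement by the mechanics equation ([displacement_le_pressure]).  When
    the fields of [Vh] in the kernel of the energy form are null in [H^1], the
    energy dominates the [H^1] norm on [Vh], the space being finite-dimensional
    ([psd_dominated]).

    Existence of a Biot solution is linear algebra at each time level: the form
    of the coupled system is, on the diagonal, the sum of the elastic, storage
    and Darcy energies, so it suffices that the loads vanish wherever these
    energies do ([solvable_of_null_compat]).  For the body load this can fail
    if some rigid motion is admissible; but then the mechanics step itself
    would have no solution, so the existence of iterates excludes it
    ([body_load_null]).

    Fields are functions and not classes of functions, hence all forms are only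
    semidefinite, and they are bilinear only on square integrable fields; this
    is why the algebra is done for semidefinite forms on a subspace.  Linearity
    of the integral also requires the domain to be measurable for the
    Caratheodory sigma-algebra of the box outer measure, which is proved
    first. *)

Set Implicit Arguments.
Unset Strict Implicit.
Unset Printing Implicit Defensive.

Import Order.TTheory GRing.Theory Num.Theory.
Import numFieldNormedType.Exports.

Local Open Scope classical_set_scope.
Local Open Scope ring_scope.

(** * Lebesgue measurability of open sets *)

Section lebesgue_outer_measure.
Context {R : realType} {d : nat}.
Implicit Types (a b : 'rV[R]_d) (A B X : set 'rV[R]_d) (i : 'I_d) (c : R).

Definition halfspace i c : set 'rV[R]_d := [set x | (x 0 i <= c)%R].

Definition volume (a b : 'rV[R]_d) : R := (\prod_i `|b 0 i - a 0 i|)%R.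

Definition set_coord i c (x : 'rV[R]_d) : 'rV[R]_d :=
  \row_j if j == i then c else x 0 j.

Lemma box_gauge_le_volume B a b : B `<=` box a b ->
  (gauge0 box_gauge B <= (volume a b)%:E)%E.
Proof.
move=> Bab; rewrite /gauge0; case: ifP => _.
  by rewrite lee_fin prodr_ge0.
by apply: ereal_inf_lbound; exists (a, b).
Qed.

Lemma volume_cut a b i m : (a 0 i <= m <= b 0 i)%R ->
  (volume a (set_coord i m b) + volume (set_coord i m a) b = volume a b)%R.
Proof.
move=> /andP[am mb]; rewrite /volume.
rewrite (bigD1 i)//= [X in (_ + X)%R](bigD1 i)//= [RHS](bigD1 i)//= !mxE eqxx.
rewrite (eq_bigr (fun j => `|b 0 j - a 0 j|)%R); last first.
  by move=> j /negbTE ji; rewrite mxE ji.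
rewrite [X in (_ + _ * X)%R](eq_bigr (fun j => `|b 0 j - a 0 j|)%R); last first.
  by move=> j /negbTE ji; rewrite mxE ji.
rewrite -mulrDl; congr (_ * _)%R.
by rewrite !ger0_norm ?subr_ge0//; [ring|exact: le_trans am mb].
Qed.

(** A hyperplane cuts a box into two boxes whose volumes add up, so cutting a
    covered set costs nothing; this is what makes half-spaces measurable. *)
Lemma gauge_halfspace B i c :
  (gauge0 box_gauge (B `&` halfspace i c) +
   gauge0 box_gauge (B `&` ~` halfspace i c) <= gauge0 box_gauge B)%E.
Proof.
have [->|/set0P[x0 Bx0]] := eqVneq B set0.
  by rewrite !set0I /gauge0 eqxx adde0.
rewrite [leRHS]/gauge0 ifF; last by apply/negbTE/set0P; exists x0.
apply: le_ereal_inf_tmp => _ [[a b] /= Bab <-].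
have ab j : (a 0 j <= b 0 j)%R.
  by have /andP[] := Bab _ Bx0 j; exact: le_trans.
(* The hyperplane may miss the box; it is then moved to the nearest face. *)
pose m := Num.min (Num.max c (a 0 i)) (b 0 i).
have mab : (a 0 i <= m <= b 0 i)%R.
  by rewrite /m le_min ab le_max lexx orbT /= ge_min lexx orbT.
rewrite -[leRHS]/((volume a b)%:E) -(volume_cut mab) EFinD.
apply: leeD; apply: box_gauge_le_volume => x [Bx xc] j; rewrite mxE.
  have /andP[ax xb] := Bab _ Bx j; case: eqVneq => [ji|_]; last by rewrite ax.
  move: ji ax xb => -> ax xb; rewrite ax /m le_min xb le_max.
  by move: xc; rewrite /halfspace /= => ->.
have /andP[ax xb] := Bab _ Bx j; case: eqVneq => [ji|_]; last by rewrite ax.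
move: ji ax xb => -> ax xb; rewrite xb /m ge_min ge_max ax.
by move: xc; rewrite /halfspace /= => /negP; rewrite -ltNge => /ltW ->.
Qed.

Lemma measurable_halfspace i c : measurable (halfspace i c : set (Rd R d)).
Proof.
apply: (le_caratheodory_measurable (mu := lebesgue_om R d)) => X.
have g0 B : (0 <= gauge0 box_gauge B)%E.
  by rewrite /gauge0; case: ifP => // _; exact: box_gauge_ge0.
apply: le_ereal_inf_tmp => _ [F XF <-].
apply: (@le_trans _ _ (\sum_(k <oo) gauge0 box_gauge (F k `&` halfspace i c) +
   \sum_(k <oo) gauge0 box_gauge (F k `&` ~` halfspace i c))%E).
  apply: leeD; apply: ereal_inf_lbound.
    exists (fun k => F k `&` halfspace i c) => // x [/XF[k _ Fx] xH].
    by exists k.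
  exists (fun k => F k `&` ~` halfspace i c) => // x [/XF[k _ Fx] xH].
  by exists k.
rewrite -nneseriesD//; apply: lee_nneseries => [k _ _|k _]; first exact: adde_ge0.
exact: gauge_halfspace.
Qed.

(** An open set is the union of the half-open boxes with rational corners that
    it contains, and such a box is a finite intersection of differences of
    half-spaces. *)
Lemma open_measurable_Rd A : open A -> measurable (A : set (Rd R d)).
Proof.
move=> oA.
pose cell (ab : 'rV[rat]_d * 'rV[rat]_d) : set 'rV[R]_d :=
  [set x | forall i, (ratr (ab.1 0 i) < x 0 i <= ratr (ab.2 0 i))%R].
pose P := [set ab | cell ab `<=` A].
have -> : A = \bigcup_ab (if ab \in P then cell ab else set0).
  apply/seteqP; split=> [x Ax|x [ab _]]; last first.
    by case: ifP => // /set_mem; apply.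
  have /nbhs_ballP[e /= e0 eA] := open_nbhs_nbhs (conj oA Ax).
  have lo i : {q : rat | (x 0 i - e < ratr q < x 0 i)%R}.
    apply/cid; have /rat_in_itvoo[q] : (x 0 i - e < x 0 i)%R by rewrite ltrBlDr ltrDl.
    by rewrite in_itv /= => ?; exists q.
  have hi i : {q : rat | (x 0 i < ratr q < x 0 i + e)%R}.
    apply/cid; have /rat_in_itvoo[q] : (x 0 i < x 0 i + e)%R by rewrite ltrDl.
    by rewrite in_itv /= => ?; exists q.
  exists (\row_i sval (lo i), \row_i sval (hi i)) => //.
  rewrite ifT.
    move=> i /=; rewrite !mxE.
    by case: (lo i) (hi i) => q /andP[_ ->] [r /andP[/ltW ->]].
  apply/mem_set => y /= cy; apply: eA; split=> // j i; rewrite (ord1 j) /ball /=.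
  have := cy i; rewrite !mxE.
  case: (lo i) (hi i) => q /andP[q1 q2] [r /andP[r1 r2]] /= /andP[qy yr].
  by rewrite ltr_norml; apply/andP; split; lra.
apply: countable_bigcupT_measurable; first exact: countableP.
move=> ab; case: ifP => _ //.
have -> : cell ab = \bigcap_(i in [set: 'I_d])
    (halfspace i (ratr (ab.2 0 i)) `\` halfspace i (ratr (ab.1 0 i))).
  apply/seteqP; split=> x /=.
    by move=> cx i _; have /andP[? ?] := cx i; split=> //=; apply/negP; rewrite -ltNge.
  by move=> cx i; have [? /negP] := cx i I; rewrite -ltNge => ->.
apply: fin_bigcap_measurable => // i _.
by apply: measurableD; exact: measurable_halfspace.
Qed.

Lemma normr_coord_le (x : 'rV[R]_d) i : `|x 0 i| <= `|x|.
Proof.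
rewrite [leRHS]/Num.norm /= mx_normrE.
by apply/bigmax_geP; right; exists (0, i).
Qed.

Lemma bounded_lebesgue_lty A : bounded_set A -> (lebesgue_outer A < +oo)%E.
Proof.
move=> [M [_ /(_ (M + 1))]]; rewrite ltrDl => /(_ ltr01) AM.
pose b : 'rV[R]_d := const_mx (M + 1).
apply: (@le_lt_trans _ _ (volume (- b) b)%:E); last exact: ltry.
pose F (k : nat) := if k == 0%N then A else set0.
apply: (@le_trans _ _ (\sum_(k <oo) gauge0 box_gauge (F k))%E).
  by apply: ereal_inf_lbound; exists F => // x Ax; exists 0%N.
rewrite (nneseriesD1 (n := 0%N))//; last first.
  by move=> k _; rewrite /gauge0; case: ifP => // _; exact: box_gauge_ge0.
rewrite eseries0 ?adde0.
  apply: box_gauge_le_volume => x /AM xM i; rewrite !mxE.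
  by rewrite -ler_norml; apply: le_trans xM; exact: normr_coord_le.
by move=> k _ /negbTE k0; rewrite /F k0 /gauge0 eqxx.
Qed.

End lebesgue_outer_measure.

(** * Semidefinite forms on subspaces *)

Section forms_on_subspaces.
Context {R : realType}.

Definition subspace (E : lmodType R) (S : set E) : Prop :=
  S 0 /\ forall a x y, S x -> S y -> S (a *: x + y).

Definition linear_on (E : lmodType R) (S : set E) (F : E -> R) : Prop :=
  forall a x y, S x -> S y -> F (a *: x + y) = a * F x + F y.

Definition bilinear_on (E : lmodType R) (S : set E) (f : E -> E -> R) : Prop :=
  (forall y, S y -> linear_on S (f ^~ y)) /\ (forall x, S x -> linear_on S (f x)).

Record psd_form (E : lmodType R) (S : set E) (f : E -> E -> R) : Prop := {
  psd_lin : forall y, S y -> linear_on S (f ^~ y);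
  psd_sym : forall x y, S x -> S y -> f x y = f y x;
  psd_ge0 : forall x, S x -> 0 <= f x x }.

Section one_space.
Context {E : lmodType R} {S : set E}.
Hypothesis sS : subspace S.
Implicit Types (F : E -> R) (f g : E -> E -> R).

Lemma subspaceZ a x : S x -> S (a *: x).
Proof. by case: sS => S0 SD Sx; rewrite -[_ *: _]addr0; exact: SD. Qed.

Lemma subspaceD x y : S x -> S y -> S (x + y).
Proof. by case: sS => S0 SD Sx Sy; rewrite -[x]scale1r; exact: SD. Qed.

Lemma subspaceB x y : S x -> S y -> S (x - y).
Proof.
by move=> Sx Sy; rewrite -scaleN1r; apply: subspaceD => //; exact: subspaceZ.
Qed.

Lemma subspace_sum (I : Type) (r : seq I) (e : I -> E) :
  (forall i, S (e i)) -> S (\sum_(i <- r) e i).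
Proof.
by move=> Se; apply: big_ind => //; [case: sS|exact: subspaceD].
Qed.

Lemma linear_on0 F : linear_on S F -> F 0 = 0.
Proof.
case: sS => S0 _ lF; have := lF (-1) 0 0 S0 S0.
by rewrite scaler0 addr0 mulN1r addNr.
Qed.

Lemma linear_onZ F a x : linear_on S F -> S x -> F (a *: x) = a * F x.
Proof.
case: sS => S0 _ lF Sx.
by have := lF a x 0 Sx S0; rewrite addr0 (linear_on0 lF) addr0.
Qed.

Lemma linear_onD F x y : linear_on S F -> S x -> S y -> F (x + y) = F x + F y.
Proof. by move=> lF Sx Sy; have := lF 1 x y Sx Sy; rewrite scale1r mul1r. Qed.

Lemma linear_onB F x y : linear_on S F -> S x -> S y -> F (x - y) = F x - F y.
Proof.
move=> lF Sx Sy; have := lF (-1) y x Sy Sx.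
by rewrite scaleN1r mulN1r addrC => ->; rewrite addrC.
Qed.

Lemma linear_on_sum F (I : Type) (r : seq I) (c : I -> R) (e : I -> E) :
  linear_on S F -> (forall i, S (e i)) ->
  F (\sum_(i <- r) c i *: e i) = \sum_(i <- r) c i * F (e i).
Proof.
move=> lF Se; elim: r => [|i r IHr]; first by rewrite !big_nil (linear_on0 lF).
rewrite !big_cons lF ?IHr//; apply: subspace_sum => j; exact: subspaceZ.
Qed.

Lemma psd_bilinear f : psd_form S f -> bilinear_on S f.
Proof.
move=> [fl fs _]; split=> // x Sx a y z Sy Sz; have SD := sS.2.
by rewrite fs ?fl ?[f y x]fs ?[f z x]fs//; exact: SD.
Qed.

Lemma psd_sqD f x y : psd_form S f -> S x -> S y ->
  f (x + y) (x + y) = f x x + 2 * f x y + f y y.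
Proof.
move=> pf Sx Sy; have [fl fr] := psd_bilinear pf.
have Sxy := subspaceD Sx Sy.
rewrite (linear_onD (fl _ Sxy))// (linear_onD (fr _ Sx))// (linear_onD (fr _ Sy))//.
by rewrite (psd_sym pf Sy Sx); ring.
Qed.

Lemma psd_sqZ f a x : psd_form S f -> S x -> f (a *: x) (a *: x) = a ^+ 2 * f x x.
Proof.
move=> pf Sx; have [fl fr] := psd_bilinear pf; have Sax := subspaceZ a Sx.
by rewrite (linear_onZ _ (fl _ Sax))// (linear_onZ _ (fr _ Sx))//; ring.
Qed.

Lemma psd_sqB f x y : psd_form S f -> S x -> S y ->
  f (x - y) (x - y) = f x x - 2 * f x y + f y y.
Proof.
move=> pf Sx Sy; have [fl fr] := psd_bilinear pf.
rewrite -scaleN1r psd_sqD// ?psd_sqZ//; last exact: subspaceZ.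
by rewrite (linear_onZ _ (fr _ Sx))//; ring.
Qed.

Lemma psd_young f x y : psd_form S f -> S x -> S y ->
  2 * f x y <= f x x + f y y.
Proof.
move=> pf Sx Sy.
by have := psd_ge0 pf (subspaceB Sx Sy); rewrite psd_sqB//; lra.
Qed.

Lemma psd_sqD_le f x y : psd_form S f -> S x -> S y ->
  f (x + y) (x + y) <= 2 * f x x + 2 * f y y.
Proof. by move=> pf Sx Sy; rewrite psd_sqD//; have := psd_young pf Sx Sy; lra. Qed.

(** When [f x x] is positive this is [f z z >= 0] for
    [z = f x x *: y - f x y *: x]; when both squares vanish, [psd_young] for
    [x] and for [- x] gives [f x y = 0]. *)
Lemma psd_cauchy_schwarz f x y : psd_form S f -> S x -> S y ->
  f x y ^+ 2 <= f x x * f y y.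
Proof.
move=> pf.
have disc u v : S u -> S v -> 0 < f u u -> f u v ^+ 2 <= f u u * f v v.
  move=> Su Sv fu; have [fl fr] := psd_bilinear pf.
  have := psd_ge0 pf (subspaceB (subspaceZ (f u u) Sv) (subspaceZ (f u v) Su)).
  have Z := subspaceZ.
  rewrite psd_sqB ?psd_sqZ//; [|exact: Z|exact: Z].
  rewrite (linear_onZ _ (fl _ (Z _ _ Su)))// (linear_onZ _ (fr _ Sv))//.
  rewrite (psd_sym pf Sv Su) => H; rewrite -subr_ge0 -(pmulr_rge0 _ fu).
  by apply: le_trans H _; lra.
move=> Sx Sy; have := psd_ge0 pf Sx; rewrite le_eqVlt => /orP[/eqP fx|]; last first.
  exact: disc.
have := psd_ge0 pf Sy; rewrite le_eqVlt => /orP[/eqP fy|fy]; last first.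
  by rewrite mulrC (psd_sym pf Sx Sy); exact: disc.
have := psd_young pf Sx Sy; have := psd_young pf (subspaceZ (-1) Sx) Sy.
have [fl fr] := psd_bilinear pf.
rewrite psd_sqZ// (linear_onZ _ (fl _ Sy))// -fx -fy => h1 h2.
have -> : f x y = 0 by lra.
by rewrite expr0n /= mulr0.
Qed.

Lemma psd_null f x y : psd_form S f -> S x -> S y -> f x x = 0 -> f x y = 0.
Proof.
move=> pf Sx Sy fx; apply/eqP; rewrite -sqrf_eq0 eq_le sqr_ge0 andbT.
by have := psd_cauchy_schwarz pf Sx Sy; rewrite fx mul0r.
Qed.

Lemma psdD f g : psd_form S f -> psd_form S g ->
  psd_form S (fun x y => f x y + g x y).
Proof.
move=> pf pg; split=> [y Sy a x z Sx Sz|x y Sx Sy|x Sx].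
- by rewrite (psd_lin pf)// (psd_lin pg)//; ring.
- by rewrite (psd_sym pf)// (psd_sym pg).
- exact: addr_ge0 (psd_ge0 pf Sx) (psd_ge0 pg Sx).
Qed.

Lemma psdZ c f : 0 <= c -> psd_form S f -> psd_form S (fun x y => c * f x y).
Proof.
move=> c0 pf; split=> [y Sy a x z Sx Sz|x y Sx Sy|x Sx].
- by rewrite (psd_lin pf)//; ring.
- by rewrite (psd_sym pf).
- exact: mulr_ge0 c0 (psd_ge0 pf Sx).
Qed.

Lemma psd_sum (I : Type) (r : seq I) (f : I -> E -> E -> R) :
  (forall i, psd_form S (f i)) ->
  psd_form S (fun x y => \sum_(i <- r) f i x y).
Proof.
move=> pf; split=> [y Sy a x z Sx Sz|x y Sx Sy|x Sx].
- rewrite mulr_sumr -big_split /=; apply: eq_bigr => i _.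
  exact: (psd_lin (pf i)).
- by apply: eq_bigr => i _; exact: (psd_sym (pf i)).
- by apply: sumr_ge0 => i _; exact: (psd_ge0 (pf i)).
Qed.

Lemma psd_sub (S' : set E) f : S' `<=` S -> psd_form S f -> psd_form S' f.
Proof.
move=> S'S [fl fs f0]; split=> [y /S'S Sy a x z /S'S Sx /S'S Sz|x y /S'S ? /S'S|x /S'S].
- exact: fl.
- exact: fs.
- exact: f0.
Qed.

End one_space.

Lemma psd_comp (E E' : lmodType R) (S : set E) (S' : set E') (h : E -> E')
    (f : E' -> E' -> R) :
  linear h -> (forall x, S x -> S' (h x)) -> psd_form S' f ->
  psd_form S (fun x y => f (h x) (h y)).
Proof.
move=> hl hS pf; split=> [y Sy a x z Sx Sz|x y Sx Sy|x Sx].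
- by rewrite hl (psd_lin pf)//; exact: hS.
- by rewrite (psd_sym pf)//; exact: hS.
- exact: (psd_ge0 pf (hS _ Sx)).
Qed.

Lemma finite_dim_is_subspace (E : lmodType R) (S : set E) :
  finite_dim_subspace S -> subspace S.
Proof.
move=> [m [e ->]]; split=> [|a _ _ [c _ <-] [c' _ <-]].
  by exists (fun=> 0) => //; apply: big1 => i _; rewrite scale0r.
exists (fun i => a * c i + c' i) => //.
rewrite scaler_sumr -big_split /=; apply: eq_bigr => i _.
by rewrite scalerDl scalerA.
Qed.

Lemma finite_dim_spanned (E : lmodType R) (S : set E) : finite_dim_subspace S ->
  exists m (e : 'I_m -> E), (forall k, S (e k)) /\
    forall x, S x -> exists c : 'I_m -> R, x = \sum_k c k *: e k.
Proof.
move=> [m [e ->]]; exists m, e; split=> [k|_ [c _ <-]]; last by exists c.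
exists (fun j => (j == k)%:R) => //; rewrite (bigD1 k)//= eqxx scale1r big1 ?addr0//.
by move=> j /negbTE ->; rewrite scale0r.
Qed.

Lemma finite_dim_prod (E E' : lmodType R) (S : set E) (S' : set E') :
  finite_dim_subspace S -> finite_dim_subspace S' ->
  finite_dim_subspace [set x : E * E' | S x.1 /\ S' x.2].
Proof.
move=> [m [e ->]] [m' [e' ->]].
pose b (k : 'I_(m + m')) : E * E' :=
  match fintype.split k with inl i => (e i, 0) | inr j => (0, e' j) end.
have bE c : \sum_k c k *: b k =
    (\sum_i c (lshift m' i) *: e i, \sum_j c (rshift m j) *: e' j).
  rewrite big_split_ord /=.
  rewrite (eq_bigr (fun i => (c (lshift m' i) *: e i, 0))); last first.
    move=> i _; rewrite /b; case: split_ordP => [j /lshift_inj <-|j /eqP].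
      by congr (_, _); rewrite scaler0.
    by rewrite eq_lrshift.
  rewrite [X in _ + X](eq_bigr (fun i => (0, c (rshift m i) *: e' i))); last first.
    move=> i _; rewrite /b; case: split_ordP => [j /eqP|j /rshift_inj <-].
      by rewrite eq_rlshift.
    by congr (_, _); rewrite scaler0.
  have fstS n (w : 'I_n -> E * E') : \sum_i w i = (\sum_i (w i).1, \sum_i (w i).2).
    by elim: n w => [|n IHn] w; rewrite ?big_ord0// !big_ord_recl IHn.
  rewrite !fstS /=; congr (_, _) => /=.
  - by rewrite [X in _ + X]big1 ?addr0.
  - by rewrite [X in X + _]big1 ?add0r.
exists (m + m')%N, b; apply/seteqP; split=> [[x y] /= [[c _ <-] [c' _ <-]]|_ [c _ <-]].
  exists (fun k => match fintype.split k with inl i => c i | inr j => c' j end) => //.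
  rewrite bE; congr (_, _); apply: eq_bigr => i _.
  - case: split_ordP => [j /lshift_inj <-//|j /eqP].
    by rewrite eq_lrshift.
  - case: split_ordP => [j /eqP|j /rshift_inj <-//].
    by rewrite eq_rlshift.
rewrite bE; split=> /=; first by exists (fun i => c (lshift m' i)).
by exists (fun j => c (rshift m j)).
Qed.

Section finite_dimension.
Context {E : lmodType R} {S : set E}.
Hypothesis fS : finite_dim_subspace S.
Let sS : subspace S := finite_dim_is_subspace fS.

(** A linear system is solvable when its right-hand side annihilates the kernel
    of the transposed matrix, and a kernel vector [x] has [M x x = 0].  The
    form of the coupled system is not symmetric, but its coupling terms cancel
    on the diagonal, which makes this the appropriate criterion. *)
Lemma solvable_of_null_compat (M : E -> E -> R) (F : E -> R) :
  bilinear_on S M -> linear_on S F ->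
  (forall x, S x -> M x x = 0 -> F x = 0) ->
  exists2 x, S x & forall y, S y -> M x y = F y.
Proof.
move=> [Ml Mr] lF MF; have [m [e [Se spanS]]] := finite_dim_spanned fS.
pose A : 'M[R]_m := \matrix_(i, j) M (e i) (e j).
pose f : 'rV[R]_m := \row_j F (e j).
have SS c : S (\sum_k c k *: e k).
  by apply: (subspace_sum sS) => k; exact: (subspaceZ sS).
have : (f <= A)%MS.
  rewrite submxE; apply/eqP/matrixP => i j; rewrite ord1 [RHS]mxE mxE.
  pose z k := cokermx A k j.
  have Az i' : \sum_k A i' k * z k = 0.
    by have /matrixP/(_ i' j) := mulmx_coker A; rewrite !mxE.
  have <- : F (\sum_k z k *: e k) = \sum_k f 0 k * cokermx A k j.
    rewrite (linear_on_sum sS)//; apply: eq_bigr => k _.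
    by rewrite mxE mulrC.
  apply: MF => //; rewrite (linear_on_sum sS _ _ (Ml _ (SS _)))//.
  apply: big1 => i' _; rewrite (linear_on_sum sS _ _ (Mr _ (Se i')))//.
  rewrite [X in _ * X](eq_bigr (fun k => A i' k * z k)) ?Az ?mulr0//.
  by move=> k _; rewrite mxE mulrC.
move=> /submxP[c fcA]; exists (\sum_k c 0 k *: e k) => // y /spanS[c' ->].
rewrite (linear_on_sum sS _ _ (Mr _ (SS _)))// (linear_on_sum sS)//.
apply: eq_bigr => j _; congr (_ * _).
rewrite (linear_on_sum sS _ _ (Ml _ (Se j)))//.
have /matrixP/(_ 0 j) := fcA; rewrite !mxE => ->.
by apply: eq_bigr => k _; rewrite mxE.
Qed.

(** Finite-dimensional equivalence of seminorms, without compactness.  The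
    functionals [g (e k)] vanish on the kernel of [f], hence are represented by
    [f] and bounded by Cauchy-Schwarz; and [g x x] is a quadratic form in the
    values [g (e k) x], whose matrix is a generalized inverse of the Gram matrix
    of [g]. *)
Lemma psd_dominated (f g : E -> E -> R) : psd_form S f -> psd_form S g ->
  (forall x, S x -> f x x = 0 -> g x x = 0) ->
  exists2 C, 0 <= C & forall x, S x -> g x x <= C * f x x.
Proof.
move=> pf pg fg; have [m [e [Se spanS]]] := finite_dim_spanned fS.
have [gl gr] := psd_bilinear sS pg.
have rep k : exists w, S w /\ forall x, S x -> f w x = g (e k) x.
  have [|w Sw wP] := solvable_of_null_compat (psd_bilinear sS pf) (gr _ (Se k)).
    by move=> x Sx /(fg _ Sx) gx; rewrite (psd_sym pg)// (psd_null sS pg).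
  by exists w.
have [w wP] := choice rep.
pose G : 'M[R]_m := \matrix_(i, j) g (e i) (e j).
pose P := pinvmx G.
pose C := \sum_k \sum_l `|P k l| * (f (w k) (w k) + f (w l) (w l)).
have C0 : 0 <= C.
  apply: sumr_ge0 => k _; apply: sumr_ge0 => l _.
  by rewrite mulr_ge0// addr_ge0// (psd_ge0 pf)//; have [] := wP k; have [] := wP l.
exists C => // x Sx; have [c xc] := spanS _ Sx.
pose y k := g (e k) x.
have y2 k : y k ^+ 2 <= f (w k) (w k) * f x x.
  by have [Sw wx] := wP k; rewrite /y -wx//; exact: (psd_cauchy_schwarz sS).
have gxx : g x x = \sum_k \sum_l P k l * (y k * y l).
  pose cv : 'rV[R]_m := \row_k c k.
  have yE k : y k = (cv *m G) 0 k.
    rewrite /y xc (linear_on_sum sS _ _ (gr _ (Se k)))// mxE.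
    by apply: eq_bigr => j _; rewrite !mxE (psd_sym pg).
  have -> : g x x = (cv *m G *m cv^T) 0 0.
    rewrite [X in g X _]xc (linear_on_sum sS _ _ (gl _ Sx))// -mulmxA mxE.
    apply: eq_bigr => k _; rewrite !mxE; congr (_ * _).
    rewrite xc (linear_on_sum sS _ _ (gr _ (Se k)))//.
    by apply: eq_bigr => j _; rewrite !mxE mulrC.
  have GT : G^T = G by apply/matrixP => i j; rewrite !mxE (psd_sym pg).
  have -> : cv *m G *m cv^T = (cv *m G) *m P *m (cv *m G)^T.
    have GPG : G *m P *m G = G by exact: mulmxKpV.
    by rewrite trmx_mul GT -{1}GPG !mulmxA.
  rewrite mxE exchange_big /=; apply: eq_bigr => l _.
  rewrite [(_^T) _ _]mxE [X in X * _]mxE mulr_suml; apply: eq_bigr => k _.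
  by rewrite -!yE; ring.
rewrite gxx /C mulr_suml; apply: ler_sum => k _; rewrite mulr_suml.
apply: ler_sum => l _; apply: le_trans (ler_norm _) _.
rewrite normrM -mulrA ler_wpM2l//.
have := y2 k; have := y2 l; rewrite mulrDl => hl hk.
have : `|y k * y l| <= y k ^+ 2 + y l ^+ 2.
  rewrite normrM -[y k ^+ 2]real_normK ?num_real// -[y l ^+ 2]real_normK ?num_real//.
  by have := sqr_ge0 (`|y k| - `|y l|); have := sqr_ge0 (`|y k| + `|y l|); nra.
by lra.
Qed.

End finite_dimension.

End forms_on_subspaces.

Lemma psd_ext (R : realType) (E : lmodType R) (S : set E) (f g : E -> E -> R) :
  subspace S -> (forall x y, S x -> S y -> f x y = g x y) ->
  psd_form S g -> psd_form S f.
Proof.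
move=> [_ SD] fg pg; split=> [y Sy a x z Sx Sz|x y Sx Sy|x Sx].
- by rewrite !fg ?(psd_lin pg)//; exact: SD.
- by rewrite !fg// (psd_sym pg).
- by rewrite fg// (psd_ge0 pg).
Qed.

(** For [f] the [L^2] product and [e i] the diagonal strains, this is the source
    of the factor [1/d] in the admissible range of [L]. *)
Lemma psd_sq_sum_le (R : realType) (E : lmodType R) (S : set E)
    (f : E -> E -> R) (n : nat) (e : 'I_n -> E) :
  subspace S -> psd_form S f -> (forall i, S (e i)) ->
  f (\sum_i e i) (\sum_i e i) <= n%:R * \sum_i f (e i) (e i).
Proof.
move=> sS pf Se; have [fl fr] := psd_bilinear sS pf.
have Ssum : S (\sum_i e i) by exact: (subspace_sum sS).
have one (F : E -> R) : linear_on S F -> F (\sum_i e i) = \sum_i F (e i).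
  move=> lF; rewrite (eq_bigr (fun i => 1 *: e i)); last by move=> *; rewrite scale1r.
  by rewrite (linear_on_sum sS _ _ lF)//; apply: eq_bigr => i _; rewrite mul1r.
rewrite (one _ (fl _ Ssum)).
apply: (@le_trans _ _ (\sum_i \sum_j (f (e i) (e i) + f (e j) (e j)) / 2)).
  apply: ler_sum => i _; rewrite (one _ (fr _ (Se i))); apply: ler_sum => j _.
  by have := psd_young sS pf (Se i) (Se j); lra.
rewrite (eq_bigr (fun i => n%:R * f (e i) (e i) / 2 + (\sum_j f (e j) (e j)) / 2)).
  rewrite big_split /= sumr_const card_ord -mulr_suml -mulr_sumr.
  by rewrite -[X in _ + X]mulr_natl; lra.
move=> i _; rewrite -mulr_suml big_split /= sumr_const card_ord.
by rewrite -[X in (X + _) / _]mulr_natl mulrDl.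
Qed.

(** * Square integrable functions *)

Section square_integrable_functions.
Context {R : realType} {d : nat} (Omega : set 'rV[R]_d).
Hypothesis mOmega : measurable (Omega : set (Rd R d)).
Implicit Types (f g : 'rV[R]_d -> R).

Definition integrable_on f : Prop :=
  (Leb : {measure set (Rd R d) -> \bar R}).-integrable Omega (fun x => (f x)%:E).

Lemma integrable_on0 : integrable_on (fun=> 0).
Proof. exact: integrable0. Qed.

Lemma integrable_onD f g : integrable_on f -> integrable_on g ->
  integrable_on (fun x => f x + g x).
Proof.
move=> intf intg; rewrite /integrable_on; under eq_fun do rewrite EFinD.
exact: integrableD.
Qed.

Lemma integrable_onZ a f : integrable_on f -> integrable_on (fun x => a * f x).
Proof.
move=> intf; rewrite /integrable_on; under eq_fun do rewrite EFinM.
exact: integrableZl.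
Qed.

Lemma integrable_on_sum (I : Type) (r : seq I) (F : I -> 'rV[R]_d -> R) :
  (forall i, integrable_on (F i)) -> integrable_on (fun x => \sum_(i <- r) F i x).
Proof.
move=> intF; elim: r => [|i r IHr].
  by under eq_fun do rewrite big_nil; exact: integrable_on0.
by under eq_fun do rewrite big_cons; exact: integrable_onD.
Qed.

Lemma Rintegral_sum (I : Type) (r : seq I) (F : I -> 'rV[R]_d -> R) :
  (forall i, integrable_on (F i)) ->
  \int[Leb]_(x in Omega) (\sum_(i <- r) F i x) =
  \sum_(i <- r) \int[Leb]_(x in Omega) F i x.
Proof.
move=> intF; elim: r => [|i r IHr].
  rewrite big_nil; under eq_Rintegral do rewrite big_nil.
  by rewrite (Rintegral_cst _ mOmega) mul0r.
rewrite big_cons -IHr; under eq_Rintegral do rewrite big_cons.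
by rewrite RintegralD//; [exact: intF|exact: integrable_on_sum].
Qed.

Lemma integrable_mul f g : square_integrable Omega f -> square_integrable Omega g ->
  integrable_on (fun x => f x * g x).
Proof.
move=> [mf if2] [mg ig2].
apply: (@le_integrable _ _ _ _ _ mOmega _ (fun x => (f x ^+ 2 + g x ^+ 2)%:E)).
- by apply/measurable_EFinP; exact: measurable_funM.
- move=> x _ /=; rewrite lee_fin normrM [leRHS]ger0_norm ?addr_ge0 ?sqr_ge0//.
  rewrite -[f x ^+ 2]real_normK ?num_real// -[g x ^+ 2]real_normK ?num_real//.
  by have := sqr_ge0 (`|f x| - `|g x|); have := sqr_ge0 (`|f x| + `|g x|); nra.
- exact: integrable_onD.
Qed.

Lemma square_integrable_subspace :
  subspace (square_integrable Omega : set ('rV[R]_d -> R)).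
Proof.
split=> [|a f g hf hg].
  split; first exact: measurable_cst.
  have -> : (fun x : Rd R d => ((0 : 'rV[R]_d -> R) x ^+ 2)%:E) = cst 0%E.
    by apply/funext => x; rewrite /= expr0n.
  exact: integrable0.
split.
  apply: measurable_funD; last by case: hg.
  by apply: measurable_funM; [exact: measurable_cst|case: hf].
rewrite -[X in integrable _ _ X]/(fun x : Rd R d => ((a * f x + g x) ^+ 2)%:E).
have -> : (fun x : Rd R d => ((a * f x + g x) ^+ 2)%:E) =
   (fun x => (a ^+ 2 * (f x * f x) + (2 * a * (f x * g x) + g x * g x))%:E).
  by apply/funext => x; congr EFin; ring.
apply: integrable_onD; first by apply/integrable_onZ/integrable_mul.
by apply: integrable_onD; [apply/integrable_onZ|]; exact: integrable_mul.
Qed.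

Lemma ip_psd : psd_form (square_integrable Omega : set ('rV[R]_d -> R)) (ip Omega).
Proof.
split=> [g hg a f h hf hh|f g _ _|f _].
- rewrite /ip -RintegralZl//; last exact: integrable_mul.
  rewrite -RintegralD//; [|by apply: integrable_onZ; exact: integrable_mul
                          |exact: integrable_mul].
  by apply: eq_Rintegral => x _; rewrite mulrA -mulrDl.
- by apply: eq_Rintegral => x _; rewrite mulrC.
- by apply: Rintegral_ge0 => x _; rewrite -expr2 sqr_ge0.
Qed.

Lemma square_integrable_cst c : (Leb (Omega : set (Rd R d)) < +oo)%E ->
  square_integrable Omega (fun=> c).
Proof.
move=> fO; split; first exact: measurable_cst.
apply/integrableP; split; first exact/measurable_EFinP/measurable_cst.
under eq_integral do rewrite abse_EFin.
rewrite (integral_cst _ mOmega) lte_mul_pinfty// lee_fin.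
Qed.

End square_integrable_functions.

(** * Square integrable fields and their forms *)

Section fields.
Context {R : realType} {d : nat} (Omega : set 'rV[R]_d).
Hypothesis mOmega : measurable (Omega : set (Rd R d)).
Hypothesis fOmega : (Leb (Omega : set (Rd R d)) < +oo)%E.
Local Notation L2 := (square_integrable Omega : set ('rV[R]_d -> R)).
Let sL2 : subspace L2 := square_integrable_subspace mOmega.
Let pip : psd_form L2 (ip Omega) := ip_psd mOmega.

Definition gradc (i : 'I_d) (p : sfield R d) : 'rV[R]_d -> R :=
  fun x => p.2 x 0 i.

Definition L2s : set (sfield R d) :=
  [set p : sfield R d | L2 p.1 /\ forall i, L2 (gradc i p)].

Definition L2v : set (vfield R d) :=
  [set u : vfield R d | forall i, L2s (component i u)].

Lemma gradc_linear i : linear (gradc i : sfield R d -> _).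
Proof. by move=> a p q; apply/funext => x; rewrite /gradc !mxE. Qed.

Lemma value_linear : linear (fst : sfield R d -> ('rV[R]_d -> R)).
Proof. by []. Qed.

Lemma component_linear i : linear (@component R d i).
Proof.
move=> a u v; congr (_, _); apply/funext => x; first by rewrite !mxE.
by apply/rowP => j; rewrite !mxE.
Qed.

Lemma L2s_subspace : subspace L2s.
Proof.
split=> [|a p q [p1 p2] [q1 q2]].
  split=> [|i]; first exact: sL2.1.
  have -> : gradc i 0 = 0 by apply/funext => x; rewrite /gradc mxE.
  exact: sL2.1.
split=> [|i]; first exact: sL2.2.
by rewrite gradc_linear; exact: sL2.2.
Qed.

Lemma L2v_subspace : subspace L2v.
Proof.
split=> [i|a u v hu hv i]; last by rewrite component_linear; exact: L2s_subspace.2.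
have -> : component i 0 = 0 :> sfield R d.
  congr (_, _); apply/funext => x; first by rewrite mxE.
  by apply/rowP => j; rewrite !mxE.
exact: L2s_subspace.1.
Qed.

Lemma H1_L2s : H1 Omega `<=` L2s.
Proof. by move=> p [p1 p2 _]. Qed.

Lemma H1v_L2v : H1v Omega `<=` L2v.
Proof. by move=> u hu i; exact: H1_L2s. Qed.

Definition strainc (i j : 'I_d) (u : vfield R d) : 'rV[R]_d -> R :=
  fun x => strain u x i j.

Lemma strainc_linear i j : linear (strainc i j : vfield R d -> _).
Proof.
move=> a u v; apply/funext => x; rewrite /strainc /strain /= !mxE.
by rewrite -[RHS]/(a * _ + _) !mxE; ring.
Qed.

Lemma divg_linear : linear (@divg R d).
Proof.
by move=> a u v; apply/funext => x; rewrite /divg /= mxtraceD mxtraceZ.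
Qed.

Lemma straincE i j u : strainc i j u =
  2^-1 *: gradc j (component i u) + 2^-1 *: gradc i (component j u).
Proof.
apply/funext => x.
rewrite -[RHS]/(2^-1 * row i (u.2 x) 0 j + 2^-1 * row j (u.2 x) 0 i).
by rewrite /strainc /strain !mxE mulrDr.
Qed.

Lemma L2_strainc i j u : L2v u -> L2 (strainc i j u).
Proof.
move=> hu; rewrite straincE.
apply: (subspaceD sL2); apply: (subspaceZ sL2); [exact: (hu i).2|exact: (hu j).2].
Qed.

Lemma divgE u : divg u = \sum_i strainc i i u.
Proof.
apply/funext => x; rewrite fct_sumE /divg /mxtrace; apply: eq_bigr => i _.
by rewrite /strainc /strain !mxE; lra.
Qed.

Lemma L2_divg u : L2v u -> L2 (divg u).
Proof.
by move=> hu; rewrite divgE; apply: (subspace_sum sL2) => i; exact: L2_strainc.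
Qed.

Definition strain_form (u v : vfield R d) : R :=
  \sum_i \sum_j ip Omega (strainc i j u) (strainc i j v).

Lemma psd_strain_form : psd_form L2v strain_form.
Proof.
apply: psd_sum => i; apply: psd_sum => j.
by apply: psd_comp pip; [exact: strainc_linear|move=> u; exact: L2_strainc].
Qed.

Lemma strain_formE u v : L2v u -> L2v v ->
  \int[Leb]_(x in Omega) frob (strain u x) (strain v x) = strain_form u v.
Proof.
move=> hu hv; rewrite /frob (Rintegral_sum mOmega); last first.
  move=> i; apply: (integrable_on_sum mOmega) => j.
  exact: (integrable_mul mOmega (L2_strainc i j hu) (L2_strainc i j hv)).
apply: eq_bigr => i _; rewrite (Rintegral_sum mOmega)// => j.
exact: (integrable_mul mOmega (L2_strainc i j hu) (L2_strainc i j hv)).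
Qed.

Lemma psd_div_form : psd_form L2v (fun u v => ip Omega (divg u) (divg v)).
Proof.
by apply: psd_comp pip; [exact: divg_linear|move=> u; exact: L2_divg].
Qed.

Lemma div_le_strain u : L2v u ->
  ip Omega (divg u) (divg u) <= d%:R * strain_form u u.
Proof.
move=> hu; rewrite divgE.
apply: le_trans (psd_sq_sum_le sL2 pip (fun i => L2_strainc i i hu)) _.
rewrite ler_wpM2l ?ler0n//; apply: ler_sum => i _.
rewrite (bigD1 i)//= lerDl; apply: sumr_ge0 => j _.
by rewrite (psd_ge0 pip)//; exact: L2_strainc.
Qed.

Definition mass_form (p q : sfield R d) : R := ip Omega p.1 q.1.

Definition grad_form (p q : sfield R d) : R :=
  \sum_i ip Omega (gradc i p) (gradc i q).

Lemma psd_mass_form : psd_form L2s mass_form.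
Proof. by apply: psd_comp pip; [exact: value_linear|move=> u []]. Qed.

Lemma psd_grad_form : psd_form L2s grad_form.
Proof.
apply: psd_sum => i.
by apply: psd_comp pip; [exact: gradc_linear|move=> u [_]; exact].
Qed.

Lemma H1_sqnormE p : H1_sqnorm Omega p = mass_form p p + grad_form p p.
Proof. by []. Qed.

Definition H1v_form (u v : vfield R d) : R :=
  \sum_i (mass_form (component i u) (component i v) +
          grad_form (component i u) (component i v)).

Lemma psd_H1v_form : psd_form L2v H1v_form.
Proof.
apply: psd_sum => i.
apply: (psd_comp (S' := L2s) (h := component i)
  (f := fun p q => mass_form p q + grad_form p q)); first exact: component_linear.
  by move=> u; exact.
by apply: psdD; [exact: psd_mass_form|exact: psd_grad_form].
Qed.

Lemma H1v_sqnormE u : H1v_sqnorm Omega u = H1v_form u u.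
Proof. by []. Qed.

Lemma linear_ipl f : L2 f -> linear_on L2 (ip Omega f).
Proof. by move=> hf; have [_ lr] := psd_bilinear sL2 pip; exact: lr. Qed.

Lemma linear_ipr f : L2 f -> linear_on L2 (ip Omega ^~ f).
Proof. by move=> hf; have [ll _] := psd_bilinear sL2 pip; exact: ll. Qed.

Lemma Rintegral_dotv_cst (c : 'rV[R]_d) (g : 'rV[R]_d -> 'rV[R]_d) :
  (forall i, L2 (fun x => g x 0 i)) ->
  \int[Leb]_(x in Omega) dotv c (g x) =
  \sum_i ip Omega (fun=> c 0 i) (fun x => g x 0 i).
Proof.
move=> hg; rewrite /dotv (Rintegral_sum mOmega)// => i.
exact: (integrable_mul mOmega (square_integrable_cst mOmega _ fOmega) (hg i)).
Qed.

End fields.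

(** * The forms of the Biot problem *)

Section permeability.
Context {R : realType} {d : nat} (B : biot_data R d).
Hypothesis hB : biot_data_ok B.

Definition darcy (xi eta : 'rV[R]_d) : R :=
  dotv ((viscosity B)^-1 *: applyK B xi) eta.

Lemma dotv_mx (x y : 'rV[R]_d) : dotv x y = (x *m y^T) 0 0.
Proof. by rewrite mxE; apply: eq_bigr => i _; rewrite mxE. Qed.

Lemma darcyE x y : darcy x y =
  (viscosity B)^-1 * (x *m permeability B *m y^T) 0 0.
Proof.
by rewrite /darcy /applyK (permeability_sym hB) dotv_mx -scalemxAl [LHS]mxE.
Qed.

Lemma psd_darcy : psd_form setT darcy.
Proof.
split=> [y _ a x z _ _|x y _ _|x _]; rewrite !darcyE.
- rewrite 2!mulmxDl -2!scalemxAl [X in _ * X]mxE [X in _ * (X + _)]mxE; ring.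
- congr (_ * _); rewrite -[x *m _ *m _]trmxK [LHS]mxE !trmx_mul !trmxK mulmxA.
  by rewrite (permeability_sym hB).
- apply: mulr_ge0; first by rewrite invr_ge0 ltW// (viscosity_gt0 hB).
  have [->|x0] := eqVneq x 0; first by rewrite !mul0mx mxE.
  by have := permeability_posdef hB x0; rewrite dotv_mx => /ltW.
Qed.

Lemma psd_dotv : psd_form (setT : set 'rV[R]_d) dotv.
Proof.
split=> [y _ a x z _ _|x y _ _|x _].
- by rewrite !dotv_mx mulmxDl -scalemxAl !mxE.
- by apply: eq_bigr => i _; rewrite mulrC.
- by apply: sumr_ge0 => i _; rewrite -expr2 sqr_ge0.
Qed.

Lemma finite_dim_rV n : finite_dim_subspace (setT : set 'rV[R]_n).
Proof.
exists n, (delta_mx 0); apply/seteqP; split=> // x _.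
by exists (x 0) => //; rewrite -row_sum_delta.
Qed.

(** The permeability is only positive pointwise on vectors; a uniform constant
    comes from the finite dimension. *)
Lemma darcy_elliptic : exists2 c, 0 <= c & forall xi, dotv xi xi <= c * darcy xi xi.
Proof.
have [|c c0 cP] := psd_dominated (finite_dim_rV d) psd_darcy psd_dotv.
  move=> x _; have [->|x0] := eqVneq x 0.
    by move=> _; rewrite /dotv big1// => i _; rewrite mxE mul0r.
  rewrite darcyE -dotv_mx => /eqP.
  rewrite mulf_eq0 invr_eq0 (gt_eqF (viscosity_gt0 hB)) /=.
  by rewrite (gt_eqF (permeability_posdef hB x0)).
by exists c => // xi; exact: cP.
Qed.

End permeability.

Section biot_forms_on_L2.
Context {R : realType} {d : nat} (B : biot_data R d).
Hypothesis hB : biot_data_ok B.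
Local Notation Omega := (dom B).
Let mOmega : measurable (Omega : set (Rd R d)) := open_measurable_Rd (dom_open hB).
Let fOmega : (Leb (Omega : set (Rd R d)) < +oo)%E :=
  bounded_lebesgue_lty (dom_bounded hB).
Local Notation L2 := (square_integrable Omega : set ('rV[R]_d -> R)).
Local Notation L2s := (L2s Omega).
Local Notation L2v := (L2v Omega).
Let sL2 : subspace L2 := square_integrable_subspace mOmega.
Let pip : psd_form L2 (ip Omega) := ip_psd mOmega.
Let sL2s : subspace L2s := L2s_subspace mOmega.
Let sL2v : subspace L2v := L2v_subspace mOmega.

Lemma form_aE u v : L2v u -> L2v v -> form_a B u v =
  2 * lameG B * strain_form Omega u v + lame_lambda B * ip Omega (divg u) (divg v).
Proof. by move=> hu hv; rewrite /form_a strain_formE. Qed.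

Lemma psd_form_a : psd_form L2v (form_a B).
Proof.
apply: (psd_ext sL2v form_aE); apply: psdD; apply: psdZ.
- by rewrite mulr_ge0// ltW// (lameG_gt0 hB).
- exact: psd_strain_form.
- exact: (lame_lambda_ge0 hB).
- exact: psd_div_form.
Qed.

Lemma form_a_ge_div u : (1 <= d)%N -> L2v u ->
  (2 * lameG B / d%:R + lame_lambda B) * ip Omega (divg u) (divg u) <=
  form_a B u u.
Proof.
move=> d1 hu; rewrite form_aE// mulrDl lerD2r -mulrA ler_wpM2l//.
  by rewrite mulr_ge0// ltW// (lameG_gt0 hB).
by rewrite ler_pdivrMl ?ltr0n// div_le_strain.
Qed.

(** The expansion gives bilinearity of [form_b]; integrability of the unexpanded
    integrand allows the pointwise comparison of [grad_le_form_b]. *)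
Lemma form_b_integrand_integrable p q : L2s p -> L2s q ->
  integrable_on Omega (fun x => darcy B (p.2 x) (q.2 x)) /\
  form_b B p q = \sum_i \sum_k
     ((viscosity B)^-1 * permeability B i k) * ip Omega (gradc k p) (gradc i q).
Proof.
move=> [_ hp] [_ hq].
have darcyE x : darcy B (p.2 x) (q.2 x) = \sum_i \sum_k
   ((viscosity B)^-1 * permeability B i k) * (gradc k p x * gradc i q x).
  rewrite /darcy /dotv; apply: eq_bigr => i _.
  rewrite !mxE mulr_sumr mulr_suml; apply: eq_bigr => k _.
  by rewrite /gradc !mxE; ring.
have int1 i k : integrable_on Omega (fun x =>
    ((viscosity B)^-1 * permeability B i k) * (gradc k p x * gradc i q x)).
  by apply: (integrable_onZ mOmega); exact: (integrable_mul mOmega (hp k) (hq i)).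
have int2 i : integrable_on Omega (fun x => \sum_k
    ((viscosity B)^-1 * permeability B i k) * (gradc k p x * gradc i q x)).
  exact: (integrable_on_sum mOmega).
split.
  rewrite /integrable_on; under eq_fun do rewrite darcyE.
  exact: (integrable_on_sum mOmega).
rewrite /form_b; under eq_Rintegral => x _ do rewrite -/(darcy B _ _) darcyE.
rewrite (Rintegral_sum mOmega)//; apply: eq_bigr => i _.
rewrite (Rintegral_sum mOmega)//; apply: eq_bigr => k _.
by rewrite RintegralZl//; exact: (integrable_mul mOmega (hp k) (hq i)).
Qed.

Lemma psd_form_b : psd_form L2s (form_b B).
Proof.
split=> [q hq a p r hp hr|p q hp hq|p hp].
- have hpr := sL2s.2 a _ _ hp hr.
  rewrite !(form_b_integrand_integrable _ hq).2// mulr_sumr -big_split /=.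
  apply: eq_bigr => i _; rewrite mulr_sumr -big_split /=; apply: eq_bigr => k _.
  rewrite gradc_linear (psd_lin pip (hq.2 i) a (hp.2 k) (hr.2 k)).
  by ring.
- apply: eq_Rintegral => x _; exact: (psd_sym (psd_darcy hB)).
- by apply: Rintegral_ge0 => x _; exact: (psd_ge0 (psd_darcy hB)).
Qed.

Lemma grad_le_form_b : exists2 c, 0 <= c &
  forall p, L2s p -> grad_form Omega p p <= c * form_b B p p.
Proof.
have [c c0 cP] := darcy_elliptic hB; exists c => // p hp.
have [ib _] := form_b_integrand_integrable hp hp.
have ig i : integrable_on Omega (fun x => gradc i p x * gradc i p x).
  exact: (integrable_mul mOmega (hp.2 i) (hp.2 i)).
rewrite /grad_form /ip -(Rintegral_sum mOmega)// /form_b -RintegralZl//.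
apply: le_Rintegral => //.
- exact: (integrable_on_sum mOmega).
- exact: (integrable_onZ mOmega).
- by move=> x _; exact: cP.
Qed.

Lemma linear_body_load : linear_on L2v (body_load B).
Proof.
move=> a u v hu hv.
have E w : L2v w -> body_load B w =
    \sum_i ip Omega (fun=> (rho B *: gravity B) 0 i) (component i w).1.
  by move=> hw; apply: (Rintegral_dotv_cst mOmega fOmega) => i; exact: (hw i).1.
rewrite !E//; last exact: sL2v.2.
rewrite mulr_sumr -big_split /=; apply: eq_bigr => i _.
have lc := linear_ipl mOmega (square_integrable_cst mOmega
  ((rho B *: gravity B) 0 i) fOmega).
rewrite -(lc _ _ _ (hu i).1 (hv i).1).
by congr (ip _ _ _); exact: (congr1 fst (component_linear i a u v)).
Qed.

Lemma flow_loadE f q : L2s q -> flow_load B f q = ip Omega f q.1 +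
  \sum_i ip Omega (fun=> ((rho_f B / viscosity B) *: applyK B (gravity B)) 0 i)
                  (gradc i q).
Proof.
by move=> hq; congr (_ + _); apply: (Rintegral_dotv_cst mOmega fOmega); exact: hq.2.
Qed.

Lemma linear_flow_load f : L2 f -> linear_on L2s (flow_load B f).
Proof.
move=> hf a p q hp hq; rewrite !flow_loadE//; last exact: sL2s.2.
rewrite -[(a *: p + q).1]/(a *: p.1 + q.1) (linear_ipl mOmega hf a hp.1 hq.1).
rewrite [in LHS](eq_bigr (fun i : 'I_d =>
   a * ip Omega (fun=> ((rho_f B / viscosity B) *: applyK B (gravity B)) 0 i)
                (gradc i p) +
   ip Omega (fun=> ((rho_f B / viscosity B) *: applyK B (gravity B)) 0 i)
                (gradc i q))).
  by rewrite big_split /= -mulr_sumr; ring.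
move=> i _; rewrite gradc_linear.
exact: (linear_ipl mOmega (square_integrable_cst mOmega _ fOmega) a (hp.2 i) (hq.2 i)).
Qed.

(** A pressure of zero storage and zero Darcy energy is null, with its gradient,
    in the [L^2] sense: the load does not see it. *)
Lemma flow_load_null f q : L2 f -> L2s q ->
  mass_form Omega q q = 0 -> form_b B q q = 0 -> flow_load B f q = 0.
Proof.
move=> hf hq mq bq; have [c c0 /(_ _ hq)] := grad_le_form_b.
have ipn g h : L2 g -> L2 h -> ip Omega h h = 0 -> ip Omega g h = 0.
  by move=> hg hh h0; rewrite (psd_sym pip hg hh) (psd_null sL2 pip hh hg h0).
rewrite bq mulr0 => gq.
have gi i : ip Omega (gradc i q) (gradc i q) = 0.
  apply/eqP; rewrite eq_le (psd_ge0 pip (hq.2 i)) andbT; apply: le_trans gq.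
  rewrite /grad_form (bigD1 i)//= lerDl; apply: sumr_ge0 => j _.
  exact: (psd_ge0 pip (hq.2 j)).
rewrite flow_loadE// (ipn _ _ hf hq.1 mq) add0r big1// => i _.
exact: (ipn _ _ (square_integrable_cst mOmega _ fOmega) (hq.2 i)).
Qed.

End biot_forms_on_L2.

(** The bound starts at index 2, the first iterate whose error is computed from
    a pair that satisfies the mechanics equation. *)
Lemma geometric_cvg0 (R : realType) (f : nat -> R) (C k : R) : 0 <= k < 1 ->
  (forall i, 0 <= f i.+2 <= C * k ^+ i) -> f i @[i --> \oo] --> (0 : R).
Proof.
move=> /andP[k0 k1] fC; rewrite -(cvg_shiftn 2).
apply: (@squeeze_cvgr _ _ _ _ (fun=> 0) (fun i => C * k ^+ i)).
- by near=> i; rewrite /= ?addn2; exact: fC.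
- exact: cvg_cst.
- rewrite -[X in _ --> X](mulr0 C); apply: cvgMr.
  by apply: cvg_expr; rewrite ger0_norm.
Unshelve. all: by end_near. Qed.

(** * Contraction of the fixed-stress iteration *)

Section fixed_stress_split.
Context {R : realType} {d : nat} (B : biot_data R d) (D : discretization R d).
Variable L : R.
Hypothesis d_gt0 : (1 <= d)%N.
Hypothesis hB : biot_data_ok B.
Hypothesis hD : discretization_ok B D.
Hypothesis hL : biot_alpha B ^+ 2 /
  (2 * (2 * lameG B / d%:R + lame_lambda B)) <= L.

Local Notation Omega := (dom B).
Local Notation N := (nsteps D).
Local Notation alpha := (biot_alpha B).
Local Notation beta := (biot_beta B).
Local Notation tau := (tau D).
Local Notation L2 := (square_integrable Omega : set ('rV[R]_d -> R)).
Local Notation L2s := (L2s Omega).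
Local Notation L2v := (L2v Omega).
Local Notation sq := (fun f => ip Omega f f).
Let mOmega : measurable (Omega : set (Rd R d)) := open_measurable_Rd (dom_open hB).
Let sL2 : subspace L2 := square_integrable_subspace mOmega.
Let pip : psd_form L2 (ip Omega) := ip_psd mOmega.
Let sL2s : subspace L2s := L2s_subspace mOmega.
Let sL2v : subspace L2v := L2v_subspace mOmega.
Let sQ : subspace (Qh D) := finite_dim_is_subspace (Qh_finite_dim hD).
Let sV : subspace (Vh D) := finite_dim_is_subspace (Vh_finite_dim hD).
Let pa : psd_form L2v (form_a B) := psd_form_a hB.
Let pb : psd_form L2s (form_b B) := psd_form_b hB.
Let tau0 : 0 < tau := tau_gt0 hD.
Let beta0 : 0 < beta^-1. Proof. by rewrite invr_gt0 (biot_beta_gt0 hB). Qed.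
Let cdiv : R := 2 * lameG B / d%:R + lame_lambda B.
Let cdiv0 : 0 < cdiv.
Proof.
rewrite ltr_wpDr ?(lame_lambda_ge0 hB)// divr_gt0 ?ltr0n//.
by rewrite mulr_gt0// (lameG_gt0 hB).
Qed.
Let L_gt0 : 0 < L.
Proof.
apply: lt_le_trans hL; rewrite divr_gt0 ?exprn_gt0 ?(biot_alpha_gt0 hB)//.
exact: mulr_gt0.
Qed.

Lemma Qh_L2s p : Qh D p -> L2s p.
Proof. by move=> /(Qh_sub hD)[/H1_L2s]. Qed.

Lemma Vh_L2v u : Vh D u -> L2v u.
Proof. by move=> /(Vh_sub hD) hu i; have [/H1_L2s] := hu i. Qed.

(** The only place where the lower bound on [L] enters quantitatively. *)
Lemma stabilization_absorbs_div v : L2v v ->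
  alpha ^+ 2 * ip Omega (divg v) (divg v) <= 2 * L * form_a B v v.
Proof.
move=> hv; have h := form_a_ge_div hB d_gt0 hv.
have h0 := psd_ge0 pip (L2_divg mOmega hv).
have hL' : alpha ^+ 2 <= 2 * L * cdiv.
  by move: hL; rewrite -/cdiv ler_pdivrMr ?mulr_gt0// => h1; lra.
apply: (@le_trans _ _ (2 * L * (cdiv * ip Omega (divg v) (divg v)))).
  by rewrite mulrA ler_wpM2r.
by rewrite ler_wpM2l// mulr_ge0// ltW.
Qed.

Definition residual (p : sfield R d) (u : vfield R d) : 'rV[R]_d -> R :=
  L *: p.1 - alpha *: divg u.

Lemma L2_residual p u : L2s p -> L2v u -> L2 (residual p u).
Proof.
move=> [hp _] hu; apply: (subspaceB sL2); apply: (subspaceZ sL2) => //.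
exact: L2_divg.
Qed.

Lemma residualE p u f : L2s p -> L2v u -> L2 f ->
  ip Omega (residual p u) f = - alpha * ip Omega (divg u) f + L * ip Omega p.1 f.
Proof.
move=> [hp _] hu hf; have lf := linear_ipr mOmega hf.
have hd := L2_divg mOmega hu.
rewrite (linear_onB lf); [|exact: (subspaceZ sL2)|exact: (subspaceZ sL2)].
by rewrite !(linear_onZ sL2 _ lf)//; ring.
Qed.

Lemma residual_le p u : L2s p -> L2v u ->
  form_a B u u = alpha * ip Omega p.1 (divg u) ->
  sq (residual p u) <= L ^+ 2 * sq p.1.
Proof.
move=> hp hu mech; have hd := L2_divg mOmega hu; have [hp1 _] := hp.
have := stabilization_absorbs_div hu.
rewrite /residual (psd_sqB sL2 pip); [|exact: (subspaceZ sL2)|exact: (subspaceZ sL2)].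
have LLp : L2 (L *: p.1) by exact: (subspaceZ sL2).
rewrite !(psd_sqZ sL2 _ pip)// (linear_onZ sL2 _ (linear_ipl mOmega LLp))//.
by rewrite (linear_onZ sL2 _ (linear_ipr mOmega hd))// mech; lra.
Qed.

(** The equations satisfied by the differences of two runs: [p'] is computed
    from [p] and [u], and [u] from [p].  An arbitrary initial guess need not
    satisfy the latter relation, so the first pair of successive increments is
    an instance only when the guess is compatible. *)
Record homogeneous_step (p' p : nat -> sfield R d) (u : nat -> vfield R d) :
    Prop := {
  hs_p'0 : p' 0%N = 0;
  hs_p0 : p 0%N = 0;
  hs_u0 : u 0%N = 0;
  hs_p' : forall n, (1 <= n <= N)%N -> Qh D (p' n);
  hs_p : forall n, (1 <= n <= N)%N -> Qh D (p n);
  hs_u : forall n, (1 <= n <= N)%N -> Vh D (u n);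
  hs_mech : forall n, (1 <= n <= N)%N -> forall v, Vh D v ->
    form_a B (u n) v = alpha * ip Omega (p n).1 (divg v);
  hs_flow : forall n, (1 <= n <= N)%N -> forall q, Qh D q ->
    (beta^-1 + L) * ip Omega (dt D p' n).1 q.1 + form_b B (p' n) q =
    ip Omega (residual (dt D p n) (dt D u n)) q.1 }.

Lemma in_all_levels (E : lmodType R) (S : set E) (w : nat -> E) :
  subspace S -> w 0%N = 0 -> (forall n, (1 <= n <= N)%N -> S (w n)) ->
  forall n, (n <= N)%N -> S (w n).
Proof. by move=> [S0 _] w0 Sw [|n] nN; [rewrite w0|exact: Sw]. Qed.

Lemma dt_in (E : lmodType R) (S : set E) (w : nat -> E) n :
  subspace S -> (forall n, (n <= N)%N -> S (w n)) -> (n <= N)%N -> S (dt D w n).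
Proof.
move=> sS Sw nN; apply: (subspaceZ sS); apply: (subspaceB sS); apply: Sw => //.
exact: leq_trans (leq_pred n) nN.
Qed.

Section one_step.
Variables (p' p : nat -> sfield R d) (u : nat -> vfield R d).
Hypothesis hs : homogeneous_step p' p u.

Let Qp' := in_all_levels sQ (hs_p'0 hs) (hs_p' hs).
Let Qp := in_all_levels sQ (hs_p0 hs) (hs_p hs).
Let Vu := in_all_levels sV (hs_u0 hs) (hs_u hs).

Lemma mech_all_levels n v : (n <= N)%N -> Vh D v ->
  form_a B (u n) v = alpha * ip Omega (p n).1 (divg v).
Proof.
case: n => [|n] nN Vv; last exact: (hs_mech hs).
have hv := Vh_L2v Vv.
rewrite (hs_u0 hs) (hs_p0 hs) (linear_on0 sL2v (psd_lin pa hv)).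
by rewrite (linear_on0 sL2 (linear_ipr mOmega (L2_divg mOmega hv))) mulr0.
Qed.

Lemma mech_dt n v : (n <= N)%N -> Vh D v ->
  form_a B (dt D u n) v = alpha * ip Omega (dt D p n).1 (divg v).
Proof.
move=> nN Vv; have nN' := leq_trans (leq_pred n) nN.
have hv := Vh_L2v Vv; have hd := L2_divg mOmega hv.
have la := psd_lin pa hv; have li := linear_ipr mOmega hd.
have Lu m : (m <= N)%N -> L2v (u m) by move=> /Vu/Vh_L2v.
have Lp m : (m <= N)%N -> L2 (p m).1 by move=> /Qp/Qh_L2s[].
rewrite /dt (linear_onZ sL2v _ la); last by apply: (subspaceB sL2v); exact: Lu.
rewrite (linear_onB la); [|exact: Lu|exact: Lu].
rewrite -[(tau^-1 *: (p n - p n.-1)).1]/(tau^-1 *: ((p n).1 - (p n.-1).1)).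
rewrite (linear_onZ sL2 _ li); last by apply: (subspaceB sL2); exact: Lp.
rewrite (linear_onB li); [|exact: Lp|exact: Lp].
by rewrite !mech_all_levels//; ring.
Qed.

Lemma step_residual_le n : (n <= N)%N ->
  sq (residual (dt D p n) (dt D u n)) <= L ^+ 2 * sq (dt D p n).1.
Proof.
move=> nN; have Vd := dt_in sV Vu nN.
apply: residual_le; [exact: (Qh_L2s (dt_in sQ Qp nN))|exact: Vh_L2v|exact: mech_dt].
Qed.

(** Flow equation tested with [dt D p' n].  The factor [L / 2] in front of
    [dt D p' n] leaves the storage term and half of the stabilization on the
    left, which is stronger than the stated rate. *)
Lemma step_energy n : (1 <= n <= N)%N ->
  tau * ((beta^-1 + L / 2) * sq (dt D p' n).1) +
  (form_b B (p' n) (p' n) - form_b B (p' n.-1) (p' n.-1)) / 2 <=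
  tau * (L / 2 * sq (dt D p n).1).
Proof.
move=> n1N; have /andP[n1 nN] := n1N; have nN' := leq_trans (leq_pred n) nN.
have Qd := dt_in sQ Qp' nN; have [Ld _] := Qh_L2s Qd.
have Lp m : (m <= N)%N -> L2s (p' m) by move=> /Qp'/Qh_L2s.
set y := sq (dt D p' n).1.
have flow := hs_flow hs n1N Qd.
have Lr : L2 (residual (dt D p n) (dt D u n)).
  by apply: L2_residual; [exact: (Qh_L2s (dt_in sQ Qp nN))|exact: (Vh_L2v (dt_in sV Vu nN))].
have young := psd_young sL2 pip Lr (subspaceZ sL2 L Ld).
rewrite (psd_sqZ sL2 _ pip)// (linear_onZ sL2 _ (linear_ipl mOmega Lr))// in young.
have bound : ip Omega (residual (dt D p n) (dt D u n)) (dt D p' n).1 <=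
    L / 2 * sq (dt D p n).1 + L / 2 * y.
  have rle := step_residual_le nN.
  rewrite -(ler_pM2l L_gt0); move: young rle; rewrite -/y /=.
  by move: (ip _ _ _) (ip _ _ _) (ip _ _ _) => *; lra.
have btau : tau * form_b B (p' n) (dt D p' n) =
    form_b B (p' n) (p' n) - form_b B (p' n) (p' n.-1).
  have [_ /(_ _ (Lp _ nN)) lb] := psd_bilinear sL2s pb.
  rewrite /dt (linear_onZ sL2s _ lb); last by apply: (subspaceB sL2s); exact: Lp.
  by rewrite (linear_onB lb) ?mulrA ?divff ?mul1r//; [exact: lt0r_neq0|exact: Lp|exact: Lp].
have yb := psd_young sL2s pb (Lp _ nN) (Lp _ nN').
move: flow bound; rewrite -/y => <- /(ler_wpM2l (ltW tau0)).
rewrite [tau * (_ + form_b _ _ _)]mulrDr btau; move: yb.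
move: (form_b _ _ _) (form_b _ _ _) (form_b _ _ _) (ip _ _ _) => *; lra.
Qed.

(** The Darcy energies telescope; the first one is zero and the last one has
    the good sign. *)
Lemma step_contraction :
  \sum_(1 <= n < N.+1) tau * sq (dt D p' n).1 <=
  L / (beta^-1 + L) * \sum_(1 <= n < N.+1) tau * sq (dt D p n).1.
Proof.
have ind M : (M <= N)%N ->
    (beta^-1 + L / 2) * \sum_(1 <= n < M.+1) tau * sq (dt D p' n).1 +
    form_b B (p' M) (p' M) / 2 <=
    L / 2 * \sum_(1 <= n < M.+1) tau * sq (dt D p n).1.
  elim: M => [_|M IHM MN].
    rewrite !big_geq// !mulr0 (hs_p'0 hs) (linear_on0 sL2s (psd_lin pb sL2s.1)).
    by rewrite mul0r addr0.
  rewrite big_nat_recr//= [X in _ <= _ * X]big_nat_recr//=.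
  by have := @step_energy M.+1 MN; have := IHM (ltnW MN); rewrite /=; lra.
have b0 := psd_ge0 pb (Qh_L2s (Qp' (leqnn N))).
have y0 : 0 <= \sum_(1 <= n < N.+1) tau * sq (dt D p' n).1.
  rewrite big_nat_cond; apply: sumr_ge0 => n /andP[/andP[n1 nN] _].
  by apply: mulr_ge0; [exact: ltW|exact: (psd_ge0 pip (Qh_L2s (dt_in sQ Qp' nN)).1)].
rewrite mulrAC ler_pdivlMr ?addr_gt0//.
by have := ind N (leqnn N); have := mulr_ge0 (ltW beta0) y0; lra.
Qed.

End one_step.

(** * Bounds by the energy of the time differences *)

Definition energy (w : nat -> sfield R d) : R :=
  \sum_(1 <= n < N.+1) tau * sq (dt D w n).1.

Lemma energy_term w n : (forall m, (m <= N)%N -> L2s (w m)) -> (1 <= n <= N)%N ->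
  tau * sq (dt D w n).1 <= energy w.
Proof.
move=> Lw /andP[n1 nN]; rewrite /energy big_nat_cond.
have n_in : n \in index_iota 1 N.+1 by rewrite mem_index_iota n1.
rewrite (big_rem n n_in) /= n1 ltnS nN lerDl.
apply: sumr_ge0 => m /andP[/andP[m1 mN] _].
by apply: mulr_ge0; [exact: ltW|exact: (psd_ge0 pip (dt_in sL2s Lw mN).1)].
Qed.

Lemma energy_ge0 w : (forall m, (m <= N)%N -> L2s (w m)) -> 0 <= energy w.
Proof.
move=> Lw; rewrite /energy big_nat_cond; apply: sumr_ge0 => m /andP[/andP[m1 mN] _].
by apply: mulr_ge0; [exact: ltW|exact: (psd_ge0 pip (dt_in sL2s Lw mN).1)].
Qed.

Lemma value_le_energy n : (n <= N)%N -> exists2 C, 0 <= C &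
  forall w : nat -> sfield R d, w 0%N = 0 -> (forall m, (m <= N)%N -> L2s (w m)) ->
    sq (w n).1 <= C * energy w.
Proof.
elim: n => [_|n IHn nN].
  by exists 0 => // w -> _; rewrite mul0r (linear_on0 sL2 (linear_ipr mOmega sL2.1)).
have [C C0 CP] := IHn (ltnW nN); exists (2 * C + 2 * tau).
  by rewrite addr_ge0// mulr_ge0// ltW.
move=> w w0 Lw; have Ld := dt_in sL2s Lw nN.
have -> : (w n.+1).1 = (w n).1 + tau *: (dt D w n.+1).1.
  rewrite -[tau *: _]/((tau *: dt D w n.+1).1) -[X in X.1 = _]/(w n.+1).
  by rewrite /dt scalerA divff ?lt0r_neq0// scale1r addrCA subrr addr0.
have Lt := subspaceZ sL2 tau Ld.1.
apply: le_trans (psd_sqD_le sL2 pip (Lw _ (ltnW nN)).1 Lt) _.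
rewrite (psd_sqZ sL2 _ pip Ld.1).
have := CP w w0 Lw; have := ler_wpM2l (ltW tau0) (energy_term Lw (n := n.+1) nN).
lra.
Qed.

(** Young's inequality for [alpha (p, div u)] leaves half of [a(u, u)], by the
    choice of weights and [stabilization_absorbs_div]. *)
Lemma displacement_le_pressure p' p u n : homogeneous_step p' p u -> (n <= N)%N ->
  form_a B (u n) (u n) <= 2 * L * sq (p n).1.
Proof.
move=> hs nN.
have Vu := in_all_levels sV (hs_u0 hs) (hs_u hs) nN; have hu := Vh_L2v Vu.
have [hp _] := Qh_L2s (in_all_levels sQ (hs_p0 hs) (hs_p hs) nN).
have hd := L2_divg mOmega hu.
have Lp : L2 ((2 * L) *: (p n).1) by exact: (subspaceZ sL2).
have := psd_young sL2 pip Lp (subspaceZ sL2 alpha hd).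
rewrite !(psd_sqZ sL2 _ pip)// (linear_onZ sL2 _ (linear_ipl mOmega Lp))//.
rewrite (linear_onZ sL2 _ (linear_ipr mOmega hd))//.
have := stabilization_absorbs_div hu; have := mech_all_levels hs nN Vu.
move: (form_a B _ _) (ip _ _ _) (ip _ _ _) (ip _ _ _) => a x y z -> h1 h2.
by rewrite -(ler_pM2l L_gt0); lra.
Qed.

(** Testing the flow equation with [p' n] itself controls the Darcy energy by
    the residual, which [step_residual_le] bounds by the previous iterate. *)
Lemma pressure_H1_le_energy n : (n <= N)%N -> exists2 C, 0 <= C &
  forall p' p u, homogeneous_step p' p u ->
    H1_sqnorm Omega (p' n) <= C * (energy p' + energy p).
Proof.
move=> nN; have [C C0 CP] := value_le_energy nN.
have [k k0 kP] := grad_le_form_b hB.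
pose c := beta^-1 + L.
exists (C + k * (tau^-1 * L ^+ 2 + tau^-1 * c ^+ 2 + C)).
  by rewrite addr_ge0// mulr_ge0// !addr_ge0// mulr_ge0// ?sqr_ge0// invr_ge0 ltW.
move=> p' p u hs.
have Qp' := in_all_levels sQ (hs_p'0 hs) (hs_p' hs).
have Qp := in_all_levels sQ (hs_p0 hs) (hs_p hs).
have Vu := in_all_levels sV (hs_u0 hs) (hs_u hs).
have Lp' m : (m <= N)%N -> L2s (p' m) by move=> /Qp'/Qh_L2s.
have Lp m : (m <= N)%N -> L2s (p m) by move=> /Qp/Qh_L2s.
have E'0 := energy_ge0 Lp'; have E0 := energy_ge0 Lp.
have val := CP p' (hs_p'0 hs) Lp'.
have bnd : form_b B (p' n) (p' n) <=
    (tau^-1 * L ^+ 2 + tau^-1 * c ^+ 2 + C) * (energy p' + energy p).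
  have ti0 : 0 <= tau^-1 by rewrite invr_ge0 ltW.
  have A0 : 0 <= tau^-1 * L ^+ 2 by rewrite mulr_ge0// sqr_ge0.
  have B0 : 0 <= tau^-1 * c ^+ 2 by rewrite mulr_ge0// sqr_ge0.
  have [n0|n0] := posnP n.
    rewrite n0 (hs_p'0 hs) (linear_on0 sL2s (psd_lin pb sL2s.1)).
    by rewrite mulr_ge0// ?addr_ge0.
  have n1N : (1 <= n <= N)%N by rewrite n0.
  have tinv (w : nat -> sfield R d) : (forall m, (m <= N)%N -> L2s (w m)) ->
      sq (dt D w n).1 <= tau^-1 * energy w.
    by move=> Lw; rewrite -ler_pdivrMl ?invr_gt0// invrK; exact: energy_term.
  have hp := tinv p Lp; have hp' := tinv p' Lp'.
  have Ld := (dt_in sL2s Lp' nN).1; have Le := (Lp' n nN).1.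
  have Lr : L2 (residual (dt D p n) (dt D u n)).
    by apply: L2_residual; [exact: (dt_in sL2s Lp nN)|exact: (Vh_L2v (dt_in sV Vu nN))].
  have Lcd := subspaceZ sL2 (- c) Ld.
  have := hs_flow hs n1N (Qp' n nN).
  have := psd_young sL2 pip Lr Le; have := psd_young sL2 pip Lcd Le.
  rewrite (psd_sqZ sL2 _ pip)// (linear_onZ sL2 _ (linear_ipr mOmega Le))// -/c.
  have := step_residual_le hs nN.
  have Lhp := ler_wpM2l (sqr_ge0 L) hp; have chp := ler_wpM2l (sqr_ge0 c) hp'.
  have := mulr_ge0 A0 E'0; have := mulr_ge0 B0 E0; have := mulr_ge0 C0 E0.
  rewrite sqrrN; have := mulr_ge0 A0 E0; have := mulr_ge0 B0 E'0.
  lra.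
rewrite H1_sqnormE; have := kP _ (Lp' n nN); have := ler_wpM2l k0 bnd.
have := mulr_ge0 C0 E0; rewrite /mass_form; lra.
Qed.

(** One update of the scheme, started from a pair that already satisfies the
    initial and mechanics equations. *)
Record consistent (p' p : nat -> sfield R d) (u : nat -> vfield R d) : Prop := {
  cs_p0 : p 0%N = p_init D;
  cs_p : forall n, (1 <= n <= N)%N -> Qh D (p n);
  cs_mech : mechanics_step B D p u;
  cs_flow : flow_step B D L u p p' }.

Lemma dtB (E : lmodType R) (w z : nat -> E) n :
  dt D (fun n => w n - z n) n = dt D w n - dt D z n.
Proof. by rewrite /dt -scalerBr; congr (_ *: _); rewrite !opprD !opprK addrACA. Qed.

Lemma residualB p q u w :
  residual (p - q) (u - w) = residual p u - residual q w.
Proof.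
have dB : divg (u - w) = divg u - divg w.
  by apply/funext => x; exact: (raddfB (@mxtrace R d)).
by rewrite /residual dB [(p - q).1]/(p.1 - q.1) !scalerBr !opprD !opprK addrACA.
Qed.

Lemma consistent_L2 p' p u n : consistent p' p u -> (n <= N)%N ->
  [/\ L2s (p' n), L2s (p n) & L2v (u n)].
Proof.
move=> cs; case: n => [_|n nN].
  rewrite (cs_p0 cs) (cs_flow cs).1 (cs_mech cs).1.
  have := H1_L2s (p_init_H1 hD); have := H1v_L2v (u_init_H1 hD).
  by split.
have n1N : (1 <= n.+1 <= N)%N by [].
split; [|exact: Qh_L2s (cs_p cs n1N)|].
  by apply: Qh_L2s; have [] := (cs_flow cs).2 _ n1N.
by apply: Vh_L2v; have [] := (cs_mech cs).2 _ n1N.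
Qed.

Lemma difference_homogeneous p' p u q' q w :
  consistent p' p u -> consistent q' q w ->
  homogeneous_step (fun n => p' n - q' n) (fun n => p n - q n)
                   (fun n => u n - w n).
Proof.
move=> cp cq; split=> [|||n nN|n nN|n nN|n nN v Vv|n nN r Qr].
- by rewrite (cs_flow cp).1 (cs_flow cq).1 subrr.
- by rewrite (cs_p0 cp) (cs_p0 cq) subrr.
- by rewrite (cs_mech cp).1 (cs_mech cq).1 subrr.
- by apply: (subspaceB sQ); [have [] := (cs_flow cp).2 n nN|have [] := (cs_flow cq).2 n nN].
- by apply: (subspaceB sQ); [exact: (cs_p cp)|exact: (cs_p cq)].
- by apply: (subspaceB sV); [have [] := (cs_mech cp).2 n nN|have [] := (cs_mech cq).2 n nN].
- have [Vu mu] := (cs_mech cp).2 n nN; have [Vw mw] := (cs_mech cq).2 n nN.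
  have hv := Vh_L2v Vv; have hd := L2_divg mOmega hv.
  rewrite (linear_onB (psd_lin pa hv)); [|exact: Vh_L2v|exact: Vh_L2v].
  rewrite [(p n - q n).1]/((p n).1 - (q n).1) (linear_onB (linear_ipr mOmega hd)).
  + by rewrite mu// mw//; ring.
  + by have [] := Qh_L2s (cs_p cp nN).
  + by have [] := Qh_L2s (cs_p cq nN).
- have [Qp' fp] := (cs_flow cp).2 n nN; have [Qq' fq] := (cs_flow cq).2 n nN.
  have hr := Qh_L2s Qr; have /andP[n1 nN'] := nN.
  have lp m mN := consistent_L2 cp (n := m) mN.
  have lq m mN := consistent_L2 cq (n := m) mN.
  have dts : [/\ L2s (dt D p' n), L2s (dt D p n) & L2v (dt D u n)].
    split; [apply: (dt_in sL2s) => // m mN|apply: (dt_in sL2s) => // m mN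
           |apply: (dt_in sL2v) => // m mN]; by have [] := lp m mN.
  have dtq : [/\ L2s (dt D q' n), L2s (dt D q n) & L2v (dt D w n)].
    split; [apply: (dt_in sL2s) => // m mN|apply: (dt_in sL2s) => // m mN
           |apply: (dt_in sL2v) => // m mN]; by have [] := lq m mN.
  have [dp' dp du] := dts; have [dq' dq dw] := dtq.
  rewrite !dtB residualB (linear_onB (psd_lin pb hr)); [|exact: Qh_L2s|exact: Qh_L2s].
  have lr := linear_ipr mOmega hr.1.
  rewrite [(dt D p' n - dt D q' n).1]/((dt D p' n).1 - (dt D q' n).1).
  have rp := L2_residual dp du; have rq := L2_residual dq dw.
  rewrite (linear_onB lr dp'.1 dq'.1) (linear_onB lr rp rq).
  rewrite (residualE dp du hr.1) (residualE dq dw hr.1).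
  have := fp r Qr; have := fq r Qr.
  move: (ip _ _ _) (ip _ _ _) (ip _ _ _) (ip _ _ _) (ip _ _ _) (ip _ _ _)
        (form_b _ _ _) (form_b _ _ _) (flow_load _ _ _) => *; lra.
Qed.

Lemma consistent_iterates u p i : fixed_stress_iterates B D L u p ->
  (i = 0%N -> compatible_guess B D (u 0%N) (p 0%N)) -> consistent (p i.+1) (p i) (u i).
Proof.
move=> [[_ _ g] it]; have [fl _] := it i.+1 isT.
case: i fl => [|i] /= fl comp; first by have [? ?] := comp erefl; split=> // n /g[].
have [[p0 fi] mi] := it i.+1 isT.
by split=> // n nN; have [] := fi n nN.
Qed.

(** A Biot solution is a fixed point of the iteration: the stabilization terms
    on both sides cancel. *)
Lemma consistent_solution u p : biot_solution B D u p -> consistent p p u.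
Proof.
move=> [u0 p0 sol]; split=> //.
- by move=> n /sol[].
- split=> // n nN; have [Vu _ mech _] := sol n nN; split=> // v Vv.
  by have := mech v Vv; lra.
- split=> // n nN; have [_ Qp _ flow] := sol n nN; split=> // q Qq.
  by have := flow q Qq; lra.
Qed.

(** * Convergence to the Biot solution *)

Definition rate : R := L / (beta^-1 + L).

Lemma rate_bounds : 0 <= rate < 1.
Proof.
have cL : 0 < beta^-1 + L by rewrite addr_gt0.
rewrite /rate divr_ge0 ?(ltW L_gt0) ?(ltW cL)//=.
by rewrite ltr_pdivrMr// mul1r ltrDr.
Qed.

Lemma mechanics_unique_dominated : mechanics_unique B D -> exists2 C, 0 <= C &
  forall u, Vh D u -> H1v_sqnorm Omega u <= C * form_a B u u.
Proof.
move=> uniq; have VL : Vh D `<=` L2v := Vh_L2v.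
have pV := psd_sub VL (psd_H1v_form mOmega).
apply: (psd_dominated (Vh_finite_dim hD) (psd_sub VL pa) pV) => u Vu au.
apply: uniq => // v Vv.
exact: (psd_null sL2v pa (VL _ Vu) (VL _ Vv)).
Qed.

(** All quantities are bounded by the energies of two consecutive errors, which
    the contraction makes geometrically small. *)
Lemma iterates_converge u p uh ph : fixed_stress_iterates B D L u p ->
  biot_solution B D uh ph -> iterates_cvg B D u p uh ph.
Proof.
move=> it sol n nN.
pose ep i m := p i m - ph m; pose eu i m := u i m - uh m.
have hs i : homogeneous_step (ep i.+2) (ep i.+1) (eu i.+1).
  apply: difference_homogeneous (consistent_solution sol).
  exact: consistent_iterates.
have Lp i m : (m <= N)%N -> L2s (ep i.+1 m).
  by move=> mN; exact: (Qh_L2s (in_all_levels sQ (hs_p0 (hs i)) (hs_p (hs i)) mN)).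
have Vu i : Vh D (eu i.+1 n).
  exact: (in_all_levels sV (hs_u0 (hs i)) (hs_u (hs i)) nN).
have /andP[r0 r1] := rate_bounds.
have E0 i : 0 <= energy (ep i.+1) by exact: energy_ge0 (Lp i).
have Eg i : energy (ep i.+1) <= rate ^+ i * energy (ep 1%N).
  elim: i => [|i IHi]; first by rewrite mul1r.
  apply: le_trans (step_contraction (hs i)) _.
  by rewrite exprS -[leRHS]mulrA; exact: ler_wpM2l.
have [C C0 CP] := pressure_H1_le_energy nN.
have pressure i : 0 <= H1_sqnorm Omega (ep i.+2 n) <=
    (C * (2 * energy (ep 1%N))) * rate ^+ i.
  rewrite H1_sqnormE addr_ge0 ?(psd_ge0 (psd_mass_form mOmega) (Lp _ _ nN))//=; last first.
    exact: (psd_ge0 (psd_grad_form mOmega) (Lp _ _ nN)).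
  rewrite -H1_sqnormE; apply: le_trans (CP _ _ _ (hs i)) _.
  rewrite -mulrA ler_wpM2l// -mulrA mulr_natl mulr2n [energy _ * _]mulrC.
  apply: lerD (Eg i); apply: le_trans (Eg i.+1) _.
  rewrite ler_wpM2r// exprS -[leRHS]mul1r ler_wpM2r ?exprn_ge0//.
  exact: ltW.
have displacement i : 0 <= form_a B (eu i.+2 n) (eu i.+2 n) <=
    (2 * L * (C * (2 * energy (ep 1%N)))) * rate ^+ i.
  rewrite (psd_ge0 pa (Vh_L2v (Vu _)))/=.
  apply: le_trans (displacement_le_pressure (hs i.+1) nN) _.
  have L2_ge0 : 0 <= 2 * L by rewrite mulr_ge0// ltW.
  rewrite -[leRHS]mulrA ler_wpM2l//.
  have /andP[_] := pressure i; rewrite H1_sqnormE; apply: le_trans.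
  by rewrite lerDl (psd_ge0 (psd_grad_form mOmega) (Lp _ _ nN)).
split=> [||/mechanics_unique_dominated[C' C'0 C'P]].
- exact: geometric_cvg0 rate_bounds pressure.
- exact: geometric_cvg0 rate_bounds displacement.
- apply: (@geometric_cvg0 _ _ (C' * (2 * L * (C * (2 * energy (ep 1%N))))) _ rate_bounds) => i.
  have Vui := Vu i.+1; have /andP[_ ai] := displacement i.
  rewrite H1v_sqnormE (psd_ge0 (psd_H1v_form mOmega) (Vh_L2v Vui))/=.
  by apply: le_trans (C'P _ Vui) _; rewrite -[leRHS]mulrA; exact: ler_wpM2l.
Qed.

(** * Existence of the Biot solution *)

(** If [v] has zero elastic energy, the mechanics equation tested with [v] has
    every other term equal to zero.  This replaces Korn's inequality. *)
Lemma body_load_null u p : mechanics B D u p -> L2s p ->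
  forall v, Vh D v -> form_a B v v = 0 -> body_load B v = 0.
Proof.
move=> [Vu mech] hp v Vv av; have hv := Vh_L2v Vv; have hd := L2_divg mOmega hv.
have := mech v Vv.
rewrite (psd_sym pa (Vh_L2v Vu) hv) (psd_null sL2v pa hv (Vh_L2v Vu) av).
suff dv : ip Omega (divg v) (divg v) = 0.
  by rewrite (psd_sym pip hp.1 hd) (psd_null sL2 pip hd hp.1 dv) mulr0 add0r => <-.
have := form_a_ge_div hB d_gt0 hv; rewrite av -/cdiv => h.
apply/eqP; rewrite eq_le (psd_ge0 pip hd) andbT.
by rewrite -(ler_pM2l cdiv0) mulr0.
Qed.

(** The sum of the two equations of one backward Euler step, the second one
    multiplied by [tau]; with this scaling the coupling terms are opposite. *)
Definition step_form (x y : vfield R d * sfield R d) : R :=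
  form_a B x.1 y.1 - alpha * ip Omega x.2.1 (divg y.1) +
  alpha * ip Omega (divg x.1) y.2.1 +
  beta^-1 * ip Omega x.2.1 y.2.1 + tau * form_b B x.2 y.2.

Lemma bilinear_step_form :
  bilinear_on [set x : vfield R d * sfield R d | Vh D x.1 /\ Qh D x.2] step_form.
Proof.
split=> [[v q] [/= /Vh_L2v hv /Qh_L2s hq]|[v q] [/= /Vh_L2v hv /Qh_L2s hq]]
    a [u p] [w r] [/= /Vh_L2v hu /Qh_L2s hp] [/= /Vh_L2v hw /Qh_L2s hr].
- rewrite /step_form /= (psd_lin pa hv a hu hw) (psd_lin pb hq a hp hr).
  have hd := L2_divg mOmega.
  rewrite (linear_ipr mOmega (hd _ hv) a hp.1 hr.1) (linear_ipr mOmega hq.1 a hp.1 hr.1).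
  rewrite divg_linear (linear_ipr mOmega hq.1 a (hd _ hu) (hd _ hw)).
  by ring.
- have [_ ra] := psd_bilinear sL2v pa; have [_ rb] := psd_bilinear sL2s pb.
  rewrite /step_form /= (ra _ hv a _ _ hu hw) (rb _ hq a _ _ hp hr).
  have hd := L2_divg mOmega.
  rewrite divg_linear (linear_ipl mOmega hq.1 a (hd _ hu) (hd _ hw)).
  rewrite (linear_ipl mOmega (hd _ hv) a hp.1 hr.1) (linear_ipl mOmega hq.1 a hp.1 hr.1).
  by ring.
Qed.

Lemma biot_step_solvable n (u0 : vfield R d) (p0 : sfield R d) :
  (forall v, Vh D v -> form_a B v v = 0 -> body_load B v = 0) ->
  (1 <= n <= N)%N -> L2v u0 -> L2s p0 ->
  exists x : vfield R d * sfield R d, [/\ Vh D x.1, Qh D x.2,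
    forall v, Vh D v ->
      form_a B x.1 v - alpha * ip Omega x.2.1 (divg v) = body_load B v &
    forall q, Qh D q ->
      alpha * ip Omega (divg (tau^-1 *: (x.1 - u0))) q.1 +
      beta^-1 * ip Omega (tau^-1 *: (x.2 - p0)).1 q.1 + form_b B x.2 q =
      flow_load B (source D n) q].
Proof.
move=> null nN hu0 hp0; have hf := source_L2 hD nN.
have hd := L2_divg mOmega.
pose F (y : vfield R d * sfield R d) : R := body_load B y.1 +
  (tau * flow_load B (source D n) y.2 + alpha * ip Omega (divg u0) y.2.1 +
   beta^-1 * ip Omega p0.1 y.2.1).
have [||[u p] [/= Vu Qp] sol] := solvable_of_null_compat
    (finite_dim_prod (Vh_finite_dim hD) (Qh_finite_dim hD)) bilinear_step_form
    (F := F).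
- move=> a [u p] [w r] [/= /Vh_L2v hu /Qh_L2s hp] [/= /Vh_L2v hw /Qh_L2s hr].
  rewrite /F /= (linear_body_load hB a hu hw) (linear_flow_load hB hf a hp hr).
  rewrite (linear_ipl mOmega (hd _ hu0) a hp.1 hr.1).
  by rewrite (linear_ipl mOmega hp0.1 a hp.1 hr.1); ring.
- move=> [v q] [/= Vv Qq]; have hv := Vh_L2v Vv; have hq := Qh_L2s Qq.
  rewrite /step_form /= (psd_sym pip (hd _ hv) hq.1) => s0.
  have a0 := psd_ge0 pa hv; have m0 := psd_ge0 pip hq.1; have b0 := psd_ge0 pb hq.
  have bm0 := mulr_ge0 (ltW beta0) m0; have tb0 := mulr_ge0 (ltW tau0) b0.
  have av : form_a B v v = 0 by lra.
  have /eqP : beta^-1 * ip Omega q.1 q.1 = 0 by lra.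
  rewrite mulf_eq0 gt_eqF//= => /eqP mq.
  have /eqP : tau * form_b B q q = 0 by lra.
  rewrite mulf_eq0 gt_eqF//= => /eqP bq.
  have mn f : L2 f -> ip Omega f q.1 = 0.
    by move=> h; rewrite (psd_sym pip h hq.1) (psd_null sL2 pip hq.1 h mq).
  rewrite /F /= (null v Vv av) (flow_load_null hB hf hq mq bq).
  by rewrite (mn _ (hd _ hu0)) (mn _ hp0.1) !mulr0 !addr0.
exists (u, p); split=> // [v Vv|q Qq] /=.
- have := sol (v, 0) (conj Vv sQ.1); rewrite /step_form /F /=.
  have hu := Vh_L2v Vu; have hp := Qh_L2s Qp.
  have [_ rb] := psd_bilinear sL2s pb.
  have z f : L2 f -> ip Omega f (0 : sfield R d).1 = 0.
    by move=> h; exact: (linear_on0 sL2 (linear_ipl mOmega h)).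
  rewrite !z//; [|exact: hp0.1|exact: hd|exact: hp.1|exact: hd].
  rewrite (linear_on0 sL2s (rb _ hp)) (linear_on0 sL2s (linear_flow_load hB hf)).
  by rewrite !mulr0 !addr0.
- have := sol (0, q) (conj sV.1 Qq); rewrite /step_form /F /=.
  have hu := Vh_L2v Vu; have hp := Qh_L2s Qp; have hq := Qh_L2s Qq.
  have [_ ra] := psd_bilinear sL2v pa.
  have d0 : divg (0 : vfield R d) = 0 by apply/funext => x; exact: mxtrace0.
  rewrite (linear_on0 sL2v (ra _ hu)) (linear_on0 sL2v (linear_body_load hB)).
  rewrite d0 (linear_on0 sL2 (linear_ipl mOmega hp.1)).
  have dE : divg (tau^-1 *: (u - u0)) = tau^-1 *: (divg u - divg u0).
    apply/funext => x; rewrite -[LHS]/(\tr (tau^-1 *: (u.2 x - u0.2 x))).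
    by rewrite mxtraceZ raddfB.
  have lq := linear_ipr mOmega hq.1.
  rewrite dE.
  rewrite (linear_onZ sL2 _ lq (subspaceB sL2 (hd _ hu) (hd _ hu0))).
  rewrite (linear_onZ sL2 _ lq (subspaceB sL2 hp.1 hp0.1)).
  rewrite (linear_onB lq (hd _ hu) (hd _ hu0)) (linear_onB lq hp.1 hp0.1) => sq.
  apply: (mulfI (lt0r_neq0 tau0)); rewrite mulrDr mulrDr.
  rewrite ![tau * (_ * (tau^-1 * _))]mulrCA !mulVKf ?lt0r_neq0//.
  by lra.
Qed.

Lemma biot_solution_exists :
  (forall v, Vh D v -> form_a B v v = 0 -> body_load B v = 0) ->
  exists u p, biot_solution B D u p.
Proof.
move=> null.
pose solves n (x y : vfield R d * sfield R d) := [/\ Vh D y.1, Qh D y.2,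
    forall v, Vh D v ->
      form_a B y.1 v - alpha * ip Omega y.2.1 (divg v) = body_load B v &
    forall q, Qh D q ->
      alpha * ip Omega (divg (tau^-1 *: (y.1 - x.1))) q.1 +
      beta^-1 * ip Omega (tau^-1 *: (y.2 - x.2)).1 q.1 + form_b B y.2 q =
      flow_load B (source D n) q].
have [next nextP] : {next : nat * (vfield R d * sfield R d) -> _ & forall nx,
    (1 <= nx.1.+1 <= N)%N -> L2v nx.2.1 -> L2s nx.2.2 -> solves nx.1.+1 nx.2 (next nx)}.
  apply: (@choice _ _ (fun nx y => (1 <= nx.1.+1 <= N)%N -> L2v nx.2.1 -> L2s nx.2.2 ->
    solves nx.1.+1 nx.2 y)) => -[n [u p]] /=.
  have [[nN [hu hp]]|no] := pselect ((1 <= n.+1 <= N)%N /\ L2v u /\ L2s p).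
    by have [x xP] := biot_step_solvable null nN hu hp; exists x.
  (* Beyond the last level, and after a field outside of L2, any value does. *)
  by exists (0, 0) => nN hu hp; case: no.
pose s := fix s n := if n is m.+1 then next (m, s m) else (u_init D, p_init D).
have good n : (n <= N)%N -> L2v (s n).1 /\ L2s (s n).2.
  elim: n => [_|n IHn nN].
    by split; [exact: H1v_L2v (u_init_H1 hD)|exact: H1_L2s (p_init_H1 hD)].
  have [hu hp] := IHn (ltnW nN).
  have [Vu Qp _ _] := nextP (n, s n) nN hu hp.
  by split; [exact: Vh_L2v|exact: Qh_L2s].
exists (fun n => (s n).1), (fun n => (s n).2); split=> // -[//|n] nN.
have [hu hp] := good n (ltnW nN).
exact: (nextP (n, s n) nN hu hp).
Qed.

Lemma nsteps_gt0 : (0 < N)%N.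
Proof.
have := final_time_gt0 hD; rewrite -(nsteps_tau hD) lt0n.
by case: eqP => // ->; rewrite mul0r ltxx.
Qed.

Lemma iterates_solution_exists u p : fixed_stress_iterates B D L u p ->
  exists uh ph, biot_solution B D uh ph.
Proof.
move=> [_ it]; have [[_ flow] [_ mech]] := it 1%N isT.
have N1 : (1 <= 1 <= N)%N := nsteps_gt0.
apply: biot_solution_exists; apply: (body_load_null (mech _ N1)).
by apply: Qh_L2s; have [] := flow _ N1.
Qed.

End fixed_stress_split.

Theorem theorem2 (R : realType) (d : nat) (B : biot_data R d)
    (D : discretization R d) (L : R)
    (hd : (1 <= d <= 3)%N)
    (hB : biot_data_ok B)
    (hD : discretization_ok B D)
    (hL : biot_alpha B ^+ 2 / (2 * (2 * lameG B / d%:R + lame_lambda B)) <= L) :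
  fixed_stress_convergent B D L /\
  forall (u : nat -> nat -> vfield R d) (p : nat -> nat -> sfield R d),
    fixed_stress_iterates B D L u p ->
    forall i, (2 <= i)%N ->
      (i = 2%N -> compatible_guess B D (u 0%N) (p 0%N)) ->
      increment_energy B D p i <=
        L / ((biot_beta B)^-1 + L) * increment_energy B D p i.-1.
Proof.
have /andP[d1 _] := hd.
split=> [u p it|u p it [|[|i]] // _ comp].
  split=> [|uh ph]; first exact: (iterates_solution_exists d1 hB hD it).
  exact: (iterates_converge d1 hB hD hL it).
apply: (step_contraction d1 hB hD hL (u := fun n => u i.+1 n - u i n)).
apply: difference_homogeneous => //; apply: consistent_iterates => // i0.
by apply: comp; rewrite i0.
Qed.
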